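(* Let $r\ge2$ be a fixed integer and let $k=k_n$ satisfy $k=\Omega(\sqrt n)$ and $k\le n$. Let $\theta$ be uniformly distributed on $\Theta_k=\{v\in\{0,1\}^n:\|v\|_0=k\}$ and observe $Y=\frac{\lambda}{k^{r/2}}\theta^{\otimes r}+W$, where $W\in(\mathbb R^n)^{\otimes r}$ has i.i.d. $\mathcal N(0,1)$ entries independent of $\theta$. Suppose $\sigma_0\in\{0,1\}^n$ satisfies $\langle\sigma_0,\theta\rangle\ge\frac18k$ and $\|\sigma_0\|_0\le\frac32k$. Then for some $\gamma=\Theta(\sqrt{\log n})$, if $M=\Theta(nk^{(r+1)/2})$ (with suitable implied constants) and $$\lambda=\tilde\omega\!\left(\frac{n^{(r-1)/2}}{k^{r/2-1}}\right)$$ (i.e. $\lambda=\omega\big(L(n)\,n^{(r-1)/2}/k^{r/2-1}\big)$ for a suitable polylogarithmic factor $L(n)$), the norm-constrained Randomized Greedy Local Search on $H_{(r+1)/2,\gamma}$ with input $(Y,\sigma_0,M)$ outputs $\theta$ with probability at least $2/3$, for $n$ large.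
   Context: Notation: $\|v\|_0$ is the number of nonzero entries, $d_H$ is the Hamming distance, $\langle\cdot,\cdot\rangle$ is the entrywise inner product of tensors. Asymptotics are as $n\to\infty$ with $r$ fixed. Objective: $H_{(r+1)/2,\gamma}(\sigma)=\langle\sigma^{\otimes r},Y\rangle-\gamma\|\sigma\|_0^{(r+1)/2}$ for $\sigma\in\{0,1\}^n$. Norm-constrained Randomized Greedy Local Search (input $Y,\sigma_0,M$, parameter $\gamma$): start at $\sigma_0$ and perform $M$ iterations; in each iteration, with current state $S$, draw $\sigma'$ uniformly at random (independently of everything else) from $\{\sigma'\in\{0,1\}^n: d_H(S,\sigma')=1,\ \|\sigma'\|_0\le\frac32k\}$, and replace $S$ by $\sigma'$ if $H_{(r+1)/2,\gamma}(\sigma')-H_{(r+1)/2,\gamma}(S)>0$, otherwise keep $S$. Output the final state. *)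

(* Defs.v *)
From HB Require Import structures.
From mathcomp Require Import all_boot all_order all_algebra.
From mathcomp Require Import all_classical all_reals all_analysis.
Set Implicit Arguments.
Unset Strict Implicit.
Unset Printing Implicit Defensive.
Import Order.TTheory GRing.Theory Num.Theory numFieldNormedType.Exports.
Local Open Scope classical_set_scope.
Local Open Scope ring_scope.

(* The relations of landau.v only bound norms. The ones below are signed: they
   also force the left-hand sequence to be eventually nonnegative (for a
   nonnegative reference sequence g). *)
Definition isOmega (R : realType) (f g : nat -> R) : Prop :=
  exists2 c : R, 0 < c & \forall n \near \oo, c * g n <= f n.

Definition theta_with (R : realType) (c C : R) (f g : nat -> R) : Prop :=
  \forall n \near \oo, c * g n <= f n <= C * g n.

Definition isTheta (R : realType) (f g : nat -> R) : Prop :=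
  exists c C : R, [/\ 0 < c, 0 < C & theta_with c C f g].

Definition is_omega (R : realType) (f g : nat -> R) : Prop :=
  forall C : R, 0 < C -> \forall n \near \oo, C * g n <= f n.

Notation cube n := {ffun 'I_n -> bool}.

Definition nnz n (v : cube n) : nat := #|[pred i | v i]|.

Definition hamming n (u v : cube n) : nat := #|[pred i | u i != v i]|.

Definition sparse n (k : nat) : {set cube n} := [set v | nnz v == k].

(* Entrywise inner product, for vectors (I = 'I_n) and tensors alike. *)
Definition inner (R : realType) (I : finType) (A B : I -> R) : R :=
  \sum_i A i * B i.

Definition rvec (R : realType) n (v : cube n) : 'I_n -> R := fun i => (v i)%:R.

(* A tensor of (R^n)^{(x) r} is a function of its multi-index. *)
Notation midx r n := {ffun 'I_r -> 'I_n}.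

Definition tpow (R : realType) n r (v : 'I_n -> R) : midx r n -> R :=
  fun t => \prod_(j < r) v (t j).

Definition observation (R : realType) n r (k : nat) (lambda : R)
    (theta : cube n) (W : midx r n -> R) : midx r n -> R :=
  fun t => lambda / k%:R `^ (r%:R / 2) * tpow (rvec R theta) t + W t.

Definition objective (R : realType) n r (p gamma : R) (Y : midx r n -> R)
    (s : cube n) : R :=
  inner (tpow (rvec R s)) Y - gamma * (nnz s)%:R `^ p.

Definition neighbours (R : realType) n (k : nat) (s : cube n) : {set cube n} :=
  [set s' | (hamming s s' == 1)%N && ((nnz s')%:R <= 3 / 2 * k%:R :> R)].

Definition local_move (R : realType) n (H : cube n -> R) (s s' : cube n) :
  cube n := if 0 < H s' - H s then s' else s.

(* [local_search k H M s out] is the probability that M iterations started at s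
   end in state out, over the fresh uniform draws of the iterations (first-step
   decomposition). The neighbourhoods met along a run started at a state s with
   nnz s <= 3/2 k are never empty when 0 < k <= n. *)
Fixpoint local_search (R : realType) n (k : nat) (H : cube n -> R) (M : nat)
    (s out : cube n) : R :=
  if M is M'.+1 then
    \sum_(s' in neighbours R k s)
      #|neighbours R k s|%:R^-1 * local_search k H M' (local_move H s s') out
  else (s == out)%:R.

Definition search_objective (R : realType) n r (gamma : R)
    (Y : midx r n -> R) : cube n -> R :=
  objective ((r%:R + 1) / 2) gamma Y.

Section Model.
Context d (Omega : measurableType d) (R : realType) (P : probability Omega R).

Definition cube_measurable n (X : Omega -> cube n) : Prop :=
  forall v, measurable (X @^-1` [set v]).

Definition uniform_on n (A : {set cube n}) (X : Omega -> cube n) : Prop :=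
  forall v, P (X @^-1` [set v]) = (if v \in A then #|A|%:R^-1 else 0)%:E.

(* Mutual independence of X and of all the W t. Taking some B t = setT and
   summing over v gives the product rule for every subfamily. *)
Definition independent_family n (I : finType) (X : Omega -> cube n)
    (W : I -> {RV P >-> R}) : Prop :=
  forall (v : cube n) (B : I -> set R), (forall t, measurable (B t)) ->
  P ((X @^-1` [set v]) `&` \bigcap_t (W t @^-1` B t)) =
  (P (X @^-1` [set v]) * \prod_t P (W t @^-1` B t))%E.

Definition planted_model n r (k : nat) (theta : Omega -> cube n)
    (W : midx r n -> {RV P >-> R}) : Prop :=
  [/\ cube_measurable theta,
      uniform_on (sparse n k) theta,
      forall t (B : set R), measurable B ->
        distribution P (W t) B = normal_prob 0 1 B
    & independent_family theta W].

(* The draws of the search are independent of (theta, Y, sigma0), so the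
   probability of the event {output = theta} is the expectation of its
   conditional probability given these. *)
Definition success_probability n r (k M : nat) (gamma lambda : R)
    (theta sigma0 : Omega -> cube n) (W : midx r n -> {RV P >-> R}) : \bar R :=
  'E_P[fun w =>
    let Y := observation k lambda (theta w) (fun t => W t w) in
    local_search k (search_objective gamma Y) M (sigma0 w) (theta w)]%E.

End Model.

(* Main.v *)
(* Write X(s) for the noise summed over the support of s, kappa for
   sqrt(ln n) * k^((r-1)/2), and call coordinates of s \ theta bad, those of
   theta \ s missing. A Gaussian union bound weighted by n^(-3 d_H(s, theta))
   shows that, uniformly over the s of size at most 3k/2, the noise increments
   summed over the bad (or over the missing) flips are O(d_H(s, theta) kappa),
   a single increment is O(sqrt k kappa), and X(s) = O(k kappa).

   On this event, if at least half of the wrong coordinates are missing, the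
   signal makes the total gain of the missing flips at least kappa; otherwise
   the penalty does so for the bad flips. Hence each step raises the objective
   by kappa / n on average until theta, which is absorbing, is reached. The
   signal may be arbitrarily large, so progress is measured by an energy in which
   its strength rho is truncated to S, with S k^(r-1) = O(sqrt k kappa): when
   S < rho both objectives accept the same moves. The energy has range
   O(k^(3/2) kappa), which bounds the number of steps by O(n k^(3/2)). *)

Require Import Defs.
From HB Require Import structures.
From mathcomp Require Import all_boot all_order all_algebra.
From mathcomp Require Import all_classical all_reals all_analysis.
From mathcomp Require Import measurable_realfun normal_distribution.
From mathcomp Require Import ring lra zify.
Set Implicit Arguments.
Unset Strict Implicit.
Unset Printing Implicit Defensive.
Import Order.TTheory GRing.Theory Num.Theory numFieldNormedType.Exports.
Local Open Scope classical_set_scope.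
Local Open Scope ring_scope.

(** * Transfer of a weighted image measure from sets to functions *)

Section Replace.
Context d (Omega : measurableType d) (R : realType).
Variables (mu : {measure set Omega -> \bar R}) (Q : {measure set (measurableTypeR R) -> \bar R}).
Variables (g X : Omega -> R) (C : R).
Hypotheses (mg : measurable_fun setT g) (g0 : forall w, 0 <= g w).
Hypothesis mX : measurable_fun setT X.
Hypothesis gQ : forall B, measurable B ->
  (\int[mu]_w (g w * \1_B (X w))%:E = C%:E * Q B)%E.
Import HBNNSimple.
Local Open Scope ereal_scope.

(** The hypothesis [gQ] says that the image under [X] of the measure with density [g] is [C * Q]. A
    simple function is a finite combination of indicators of its level sets, so linearity
    suffices. *)
Lemma integral_mul_nnsfun (h : {nnsfun R >-> R}) :
  \int[mu]_w (g w * h (X w))%:E = C%:E * \int[Q]_x (h x)%:E.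
Proof.
have hy y x : (0 <= y * \1_(h @^-1` [set y]) x :> R)%R.
  by have := nnfun_muleindic_ge0 h y x; rewrite -EFinM lee_fin.
set s := finmap.enum_fset (fset_set (range h)).
have s0 y : y \in s -> (0 <= y)%R.
  by rewrite in_fset_set// inE => -[x _ <-].
have hE x : h x = (\sum_(y <- s) y * \1_(h @^-1` [set y]) x)%R.
  by rewrite [LHS]fimfunE fsbig_finite.
(* Stated for an arbitrary measure so that it serves both sides: [(mu, g, X)] on the left and
   [(Q, 1, id)] on the right. *)
have expand d' (T : measurableType d') (nu : {measure set T -> \bar R})
    (u Z : T -> R) : measurable_fun setT u -> measurable_fun setT Z ->
    (forall w, (0 <= u w)%R) ->
    \int[nu]_w (u w * h (Z w))%:E =
    \sum_(y <- s) (y%:E * \int[nu]_w (u w * \1_(h @^-1` [set y]) (Z w))%:E).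
  move=> mu' mZ u0.
  have mhZ y : measurable_fun setT (fun w => \1_(h @^-1` [set y]) (Z w) : R).
    exact: measurableT_comp.
  have -> : (fun w => (u w * h (Z w))%:E) =
      (fun w => \sum_(y <- s) (u w * (y * \1_(h @^-1` [set y]) (Z w)))%:E).
    by apply/funext => w; rewrite hE mulr_sumr sumEFin.
  rewrite ge0_integral_sum//; last 2 first.
  - move=> y; apply/measurable_EFinP/measurable_funM => //.
    exact: measurable_funM.
  - by move=> y w _; rewrite lee_fin mulr_ge0.
  rewrite big_seq [RHS]big_seq; apply: eq_bigr => y /s0 y0.
  rewrite -ge0_integralZl_EFin//; last 2 first.
  - by move=> w _; rewrite lee_fin mulr_ge0.
  - by apply/measurable_EFinP/measurable_funM.
  by apply: eq_integral => w _; rewrite -EFinM mulrCA.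
have -> : \int[Q]_x (h x)%:E = \int[Q]_x (cst 1%R x * h (id x))%:E.
  by apply: eq_integral => w _; rewrite /= mul1r.
rewrite !expand//.
rewrite big_seq [X in C%:E * X]big_seq ge0_sume_distrr; last first.
  move=> y /s0 y0; rewrite mule_ge0// integral_ge0// => w _.
  by rewrite lee_fin /= mul1r.
apply: eq_bigr => y _; rewrite gQ// muleCA; congr (_ * (_ * _)).
under eq_integral do rewrite /= mul1r.
have mhy : measurable (h @^-1` [set y]) by [].
rewrite integral_indic; [by rewrite setIT|exact: measurableT|exact: mhy].
Qed.

(** Monotone convergence along the nondecreasing simple approximations of [f]. *)
Lemma integral_mul_ge0 (f : R -> R) :
  measurable_fun setT f -> (forall x, (0 <= f x)%R) ->
  \int[mu]_w (g w * f (X w))%:E = C%:E * \int[Q]_x (f x)%:E.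
Proof.
move=> mf f0.
have mEf : measurable_fun setT (EFin \o f) by exact/measurable_EFinP.
pose h := nnsfun_approx measurableT mEf.
have hf x : (h n x)%:E @[n --> \oo] --> (f x)%:E.
  by apply: (cvg_nnsfun_approx measurableT mEf) => // y _; rewrite lee_fin.
have ndh m n x : (m <= n)%N -> (h m x <= h n x)%R.
  by move=> mn; have /lefP := nd_nnsfun_approx measurableT mEf mn; exact.
have approx d' (T : measurableType d') (nu : {measure set T -> \bar R})
    (u Z : T -> R) : measurable_fun setT u -> measurable_fun setT Z ->
    (forall w, (0 <= u w)%R) ->
    \int[nu]_w (u w * f (Z w))%:E =
    limn (fun n => \int[nu]_w (u w * h n (Z w))%:E).
  move=> mu' mZ u0; rewrite -monotone_convergence//.
  - apply: eq_integral => w _; apply/esym/cvg_lim => //.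
    under eq_fun do rewrite EFinM.
    by rewrite EFinM; apply: cvgeZl => //; exact: hf.
  - by move=> n; apply/measurable_EFinP/measurable_funM => //; exact: measurableT_comp.
  - by move=> n w _; rewrite lee_fin mulr_ge0.
  - by move=> w _ m n mn; rewrite lee_fin ler_wpM2l// ndh.
have -> : \int[Q]_x (f x)%:E = \int[Q]_x (cst 1%R x * f (id x))%:E.
  by apply: eq_integral => w _; rewrite /= mul1r.
rewrite !approx//.
under eq_fun do rewrite integral_mul_nnsfun.
rewrite limeMl//.
  congr (_ * limn _); apply/funext => n.
  by apply: eq_integral => w _; rewrite /= mul1r.
have mh k : measurable_fun setT (fun x : R => (h k x)%:E).
  exact/measurable_EFinP.
apply: ereal_nondecreasing_is_cvgn => m n mn; apply: ge0_le_integral => //.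
- by move=> w _; rewrite lee_fin.
- exact: mh.
- exact: mh.
- by move=> w _; rewrite lee_fin ndh.
Qed.
End Replace.

(** * Exponential moments of the standard Gaussian *)

Section Gauss.
Context (R : realType).
Local Open Scope ereal_scope.

Lemma integral_normal_prob_density (f : R -> R) :
  measurable_fun setT f -> (forall x, (0 <= f x)%R) ->
  \int[normal_prob 0 1]_y (f y)%:E =
  \int[lebesgue_measure]_y (normal_pdf 0 1 y * f y)%:E.
Proof.
move=> mf f0.
rewrite (@integral_mul_ge0 _ _ R lebesgue_measure (normal_prob (0:R) (1:R)) _ id 1%R) ?mul1e//.
- exact: measurable_normal_pdf.
- by move=> x; exact: normal_pdf_ge0.
- move=> B mB; rewrite mul1e.
  transitivity (\int[lebesgue_measure]_(x in B) (normal_pdf 0 1 x)%:E) => //.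
  rewrite [RHS]integral_mkcond.
  apply: eq_integral => x _; rewrite /patch indicE.
  by case: (x \in B); rewrite ?mulr1 ?mulr0.
Qed.

(** Completing the square: an exponential tilt by [x] moves the mean from 0 to [x]. *)
Lemma normal_pdf_expRM (x y : R) :
  (normal_pdf 0 1 y * expR (x * y) = expR (x ^+ 2 / 2) * normal_pdf x 1 y)%R.
Proof.
rewrite !normal_pdfE ?oner_eq0//= /normal_fun subr0 -mulrA [RHS]mulrCA.
rewrite -!expRD; congr (_ * expR _)%R.
by rewrite expr1n; field.
Qed.

Lemma integral_normal_prob_expR (x : R) :
  \int[normal_prob 0 1]_y (expR (x * y))%:E = (expR (x ^+ 2 / 2))%:E.
Proof.
rewrite integral_normal_prob_density; last 2 first.
- by apply: measurableT_comp => //; exact: measurable_funM.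
- by move=> y; exact: expR_ge0.
under eq_integral do rewrite normal_pdf_expRM EFinM.
rewrite ge0_integralZl_EFin//; last 2 first.
- by move=> y _; rewrite lee_fin normal_pdf_ge0.
- by apply/measurable_EFinP; exact: measurable_normal_pdf.
by rewrite integral_normal_pdf mule1.
Qed.
End Gauss.

(** * Union bound over a finite family of events *)

Section Union.
Context d (Omega : measurableType d) (R : realType) (P : probability Omega R).
Variables (J : finType) (E : J -> set Omega).
Hypothesis mE : forall j, measurable (E j).

Lemma set_existsE : [set w | exists j, E j w] = \big[setU/set0]_j E j.
Proof.
rewrite -bigcup_seq; apply/seteqP; split=> [w [j Ejw]|w [j _ Ejw]]; last by exists j.
by exists j => //=; rewrite mem_index_enum.
Qed.

Lemma measurable_set_exists : measurable [set w | exists j, E j w].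
Proof. by rewrite set_existsE; apply: bigsetU_measurable. Qed.

Lemma measure_set_exists_le :
  (P [set w | exists j, E j w] <= \sum_j P (E j))%E.
Proof.
rewrite set_existsE; elim: (index_enum J) => [|j s IH].
  by rewrite !big_nil measure0.
rewrite !big_cons; apply: le_trans (leeD2l _ IH).
by apply: measureU2 => //; apply: bigsetU_measurable.
Qed.
End Union.

(** * Gaussian tails restricted to an event [A] independent of the noise *)

Section Tail.
Context d (Omega : measurableType d) (R : realType) (P : probability Omega R).
Variables (I : finType) (W : I -> {RV P >-> R}) (A : set Omega).
Hypothesis mA : measurable A.
Hypothesis W_normal : forall t (B : set R), measurable B ->
  distribution P (W t) B = normal_prob 0 1 B.
Hypothesis A_W_indep : forall B : I -> set R, (forall t, measurable (B t)) ->
  P (A `&` \bigcap_t (W t @^-1` B t)) =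
  (P A * \prod_t P (W t @^-1` B t))%E.

Let mW t : measurable_fun setT (W t) := measurable_funP (W t).

Let measurable_prod_W (f : I -> R -> R) (Q : pred I) :
  (forall t, measurable_fun setT (f t)) ->
  measurable_fun setT (fun w => \1_A w * \prod_(t | Q t) f t (W t w)).
Proof.
move=> mf; apply: measurable_funM; first exact: measurable_indic.
under eq_fun do rewrite -big_filter.
apply: measurable_prod => t _; exact: measurableT_comp.
Qed.

Lemma integral_indic_prod_indic (B : I -> set R) :
  (forall t, measurable (B t)) ->
  (\int[P]_w (\1_A w * \prod_t \1_(B t) (W t w))%:E =
   P A * \prod_t normal_prob 0 1 (B t))%E.
Proof.
move=> mB.
have mWB t : measurable (W t @^-1` B t).
  by rewrite -[_ @^-1` _]setTI; exact: mW.
have -> : (\prod_t normal_prob 0 1 (B t) = \prod_t P (W t @^-1` B t))%E.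
  by apply: eq_bigr => t _; rewrite -(W_normal t).
rewrite -A_W_indep//.
have mC : measurable (\bigcap_t (W t @^-1` B t)).
  by apply: fin_bigcap_measurable => //; exact: finite_finset.
rewrite -[A `&` _]setIT -integral_indic//; last exact: measurableI.
apply: eq_integral => w _; congr (_%:E).
rewrite indicI; congr (_ * _).
rewrite [RHS]indicE; have [|/negP notC] := boolP (w \in _).
  rewrite inE => h; apply: big1 => t _; rewrite indicE.
  by rewrite mem_set//; exact: h.
have [t Bt] : exists t, ~ B t (W t w).
  by apply/existsNP => h; apply: notC; rewrite inE => t _; exact: h.
by rewrite (bigD1 t)//= indicE memNset// mul0r.
Qed.

(* Replaces the indicators by the functions indexed by [s], one at a time. *)
Lemma integral_indic_prod_seq (s : seq I) (f : I -> R -> R) (m : I -> R) :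
  (forall t, measurable_fun setT (f t)) -> (forall t x, 0 <= f t x) ->
  (forall t, \int[normal_prob 0 1]_x (f t x)%:E = (m t)%:E)%E ->
  (forall t, t \notin s -> exists2 B, measurable B & f t = \1_B) ->
  (\int[P]_w (\1_A w * \prod_t f t (W t w))%:E = P A * (\prod_t m t)%:E)%E.
Proof.
elim: s f m => [|t s IH] f m mf f0 fm fs.
  have /choice[B BP] : forall t, exists B, measurable B /\ f t = \1_B.
    by move=> t; have [//|B mB ->] := fs t; exists B.
  rewrite (_ : f = fun t => \1_(B t)); last by apply/funext => t; case: (BP t).
  rewrite integral_indic_prod_indic; last by move=> t; case: (BP t).
  rewrite -prodEFin; congr (_ * _)%E; apply: eq_bigr => t _.
  have [mB fB] := BP t.
  by rewrite -fm fB integral_indic// ?setIT.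
pose g w : R := \1_A w * \prod_(j | j != t) f j (W j w).
pose C : R := fine (P A) * \prod_(j | j != t) m j.
have PA : (fine (P A))%:E = P A by rewrite fineK// fin_num_measure.
transitivity (\int[P]_w (g w * f t (W t w))%:E)%E.
  by apply: eq_integral => w _; rewrite (bigD1 t)//= /g; congr (_%:E); ring.
rewrite (@integral_mul_ge0 _ _ _ P (normal_prob (0 : R) 1) _ _ C) //.
- rewrite fm -EFinM /C -mulrA -[(_ * m t)%R]mulrC EFinM PA.
  by rewrite [in RHS](bigD1 t).
- exact: measurable_prod_W.
- by move=> w; rewrite mulr_ge0 ?prodr_ge0.
move=> B mB.
(* The image measure is tested on indicators. With [\1_B] in place of [f t], the coordinate [t] may
   leave the list, and the induction hypothesis applies to [s]. *)
pose f' j := if j == t then \1_B else f j.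
pose m' j := if j == t then fine (normal_prob 0 1 B) else m j.
have NB : (fine (normal_prob 0 1 B))%:E = normal_prob (0 : R) 1 B.
  by rewrite fineK// (fin_num_measure (normal_prob (0 : R) 1)).
transitivity (\int[P]_w (\1_A w * \prod_j f' j (W j w))%:E)%E.
  apply: eq_integral => w _; rewrite [in RHS](bigD1 t)//= /f' eqxx /g.
  rewrite (eq_bigr (fun j => f j (W j w))); last by move=> j /negPf ->.
  congr (_%:E); ring.
rewrite (IH f' m').
- rewrite (bigD1 t)//= /m' eqxx -NB -PA -!EFinM /C.
  rewrite (eq_bigr m); last by move=> j /negPf ->.
  congr (_%:E); ring.
- by move=> j; rewrite /f'; case: eqP => // _; exact: measurable_indic.
- by move=> j x; rewrite /f'; case: eqP.
- move=> j; rewrite /f' /m'; case: eqP => // _.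
  by rewrite NB integral_indic// setIT.
- move=> j js; rewrite /f'; case: eqP => [_|/eqP jt]; first by exists B.
  by apply: fs; rewrite inE negb_or jt.
Qed.

Lemma integral_indic_expR_sum (x : I -> R) :
  (\int[P]_w (\1_A w * expR (\sum_t x t * W t w))%:E =
   P A * (expR (\sum_t x t ^+ 2 / 2))%:E)%E.
Proof.
under eq_integral do rewrite expR_sum.
rewrite expR_sum.
apply: (@integral_indic_prod_seq (enum I) (fun t y => expR (x t * y))).
- by move=> t; apply: measurableT_comp => //; exact: measurable_funM.
- by move=> t y; exact: expR_ge0.
- by move=> t; exact: integral_normal_prob_expR.
- by move=> t; rewrite mem_enum.
Qed.

Lemma gaussian_tail (c : I -> R) (u V : R) :
  0 <= u -> 0 < V -> \sum_t c t ^+ 2 <= V ->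
  (P (A `&` [set w | (u < \sum_t c t * W t w)%R]) <=
   P A * (expR (- (u ^+ 2 / (2 * V))))%:E)%E.
Proof.
move=> u0 V0 cV; set E := (X in P X).
have mS : measurable_fun setT (fun w => \sum_t c t * W t w).
  apply: measurable_sum => t; exact: measurable_funM.
have mE : measurable E.
  apply: measurableI => //.
  rewrite (_ : [set w | _] = (fun w => \sum_t c t * W t w) @^-1` `]u, +oo[).
    by rewrite -[X in measurable X]setTI; exact: mS.
  by apply/seteqP; split=> w /=; rewrite in_itv/= andbT.
(* Chernoff bound: this [l] minimizes [l^2 * V / 2 - l * u], with minimum [- u^2 / (2 * V)]. *)
pose l := u / V.
have : (P E * (expR (l * u))%:E <= P A * (expR (l ^+ 2 * V / 2))%:E)%E.
  apply: (@le_trans _ _ (\int[P]_w (\1_A w * expR (\sum_t (l * c t) * W t w))%:E)%E); last first.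
    rewrite integral_indic_expR_sum lee_wpmul2l// lee_fin ler_expR -mulr_suml.
    rewrite ler_pM2r// (eq_bigr (fun t => l ^+ 2 * c t ^+ 2)); last by move=> t _; rewrite exprMn.
    by rewrite -mulr_sumr ler_wpM2l ?sqr_ge0.
  rewrite muleC -[E]setIT -integral_indic// -ge0_integralZl_EFin//; last first.
    by apply/measurable_EFinP; exact: measurable_indic.
  apply: ge0_le_integral => //.
  - by apply: emeasurable_funM => //; apply/measurable_EFinP; exact: measurable_indic.
  - apply/measurable_EFinP/measurable_funM; first exact: measurable_indic.
    apply: measurableT_comp => //; apply: measurable_sum => t; exact: measurable_funM.
  - move=> w _; rewrite -EFinM lee_fin indicI /=.
    rewrite mulrCA ler_wpM2l//.
    rewrite indicE; have [|_] := boolP (w \in _); last by rewrite mulr0 expR_ge0.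
    rewrite inE /= mulr1 ler_expR => /ltW uS.
    under eq_bigr do rewrite -mulrA.
    by rewrite -mulr_sumr ler_wpM2l// divr_ge0// ltW.
have -> : (expR (- (u ^+ 2 / (2 * V))))%:E =
    ((expR (l ^+ 2 * V / 2))%:E * (expR (- (l * u)))%:E)%E.
  rewrite -EFinM -expRD; congr (expR _)%:E; rewrite /l; field.
  by rewrite gt_eqF.
rewrite muleA => le1.
have e1 : 1%E = ((expR (l * u))%:E * (expR (- (l * u)))%:E)%E.
  by rewrite -EFinM -expRD subrr expR0.
by rewrite -(mule1 (P E)) [in leLHS]e1 muleA; apply: lee_wpmul2r.
Qed.
Lemma measurable_gaussian_tail (c : I -> R) (u : R) :
  measurable (A `&` [set w | (u < `|\sum_t c t * W t w|)%R]).
Proof.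
apply: measurableI => //.
have mS : measurable_fun setT (fun w => `|\sum_t c t * W t w|).
  apply: measurableT_comp => //.
  by apply: measurable_sum => t; exact: measurable_funM.
rewrite (_ : [set w | _] = (fun w => `|\sum_t c t * W t w|) @^-1` `]u, +oo[).
  by rewrite -[X in measurable X]setTI; exact: mS.
by apply/seteqP; split=> w /=; rewrite in_itv/= andbT.
Qed.

Lemma gaussian_tail_abs (c : I -> R) (u V : R) :
  0 <= u -> 0 < V -> \sum_t c t ^+ 2 <= V ->
  (P (A `&` [set w | (u < `|\sum_t c t * W t w|)%R]) <=
   P A * (2 * expR (- (u ^+ 2 / (2 * V))))%:E)%E.
Proof.
move=> u0 V0 cV.
have cV' : \sum_t (- c t) ^+ 2 <= V by under eq_bigr do rewrite sqrrN.
have h1 := gaussian_tail u0 V0 cV; have h2 := gaussian_tail u0 V0 cV'.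
have mT (e : I -> R) : measurable (A `&` [set w | (u < \sum_t e t * W t w)%R]).
  apply: measurableI => //.
  have mS : measurable_fun setT (fun w => \sum_t e t * W t w).
    by apply: measurable_sum => t; exact: measurable_funM.
  rewrite (_ : [set w | _] = (fun w => \sum_t e t * W t w) @^-1` `]u, +oo[).
    by rewrite -[X in measurable X]setTI; exact: mS.
  by apply/seteqP; split=> w /=; rewrite in_itv/= andbT.
rewrite mulr_natl mulr2n EFinD ge0_muleDr ?lee_fin ?expR_ge0//.
apply: le_trans (leeD h1 h2).
apply: le_trans (measureU2 _ _ _) => //.
apply: le_measure; rewrite ?inE.
- exact: measurable_gaussian_tail.
- exact: measurableU.
move=> w [Aw] /=; rewrite lter_normr => /orP[h|h]; [left|right]; split=> //=.
by under eq_bigr do rewrite mulNr; rewrite sumrN.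
Qed.

Lemma gaussian_union_bound (J : finType) (c : J -> I -> R) (u V b : J -> R) :
  (forall j, 0 <= u j) -> (forall j, 0 < V j) ->
  (forall j, \sum_t c j t ^+ 2 <= V j) ->
  (forall j, expR (- (u j ^+ 2 / (2 * V j))) <= b j) ->
  (P (A `&` [set w | exists j, (u j < `|\sum_t c j t * W t w|)%R]) <=
   P A * (2 * \sum_j b j)%:E)%E.
Proof.
move=> u0 V0 cV ub.
rewrite (_ : A `&` _ =
    [set w | exists j, (A `&` [set w | (u j < `|\sum_t c j t * W t w|)%R]) w]).
  apply: le_trans (measure_set_exists_le _ _) _.
    by move=> j; exact: measurable_gaussian_tail.
  rewrite mulr_sumr -sumEFin ge0_sume_distrr; last first.
    by move=> j _; rewrite lee_fin mulr_ge0// (le_trans (expR_ge0 _) (ub j)).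
  apply: lee_sum => j _; apply: le_trans (gaussian_tail_abs _ (V0 j) (cV j)) _ => //.
  by rewrite lee_wpmul2l// lee_fin ler_pM2l.
by apply/seteqP; split=> w /= [] => [Aw [j uj]|j [Aw uj]]; [exists j|split=> //; exists j].
Qed.
End Tail.

(** * Lower bounds on the expected success probability *)

Section Success.
Context d (Omega : measurableType d) (R : realType) (P : probability Omega R).
Local Open Scope ereal_scope.

(* No measurability: the integral of a nonnegative function is a supremum over
   the simple functions below it. *)
Lemma ge0_le_integralT (f1 f2 : Omega -> \bar R) :
  (forall x, 0 <= f1 x) -> (forall x, f1 x <= f2 x) ->
  \int[P]_x f1 x <= \int[P]_x f2 x.
Proof.
move=> f10 f12.
have f20 x : 0 <= f2 x by exact: le_trans (f12 x).
rewrite !ge0_integralTE//; apply: le_ereal_sup => _ [h hf <-].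
by exists h => // x; exact: le_trans (f12 x).
Qed.

Lemma expectation_ge (f : Omega -> R) (G : set Omega) (c : R) :
  measurable G -> (0 <= c)%R -> (forall w, (0 <= f w)%R) ->
  (forall w, G w -> (c <= f w)%R) -> c%:E * P G <= 'E_P[f].
Proof.
move=> mG c0 f0 cf; rewrite unlock.
rewrite -[G]setIT -integral_indic// -ge0_integralZl_EFin//; last first.
  by apply/measurable_EFinP; exact: measurable_indic.
apply: ge0_le_integralT => w.
  by rewrite -EFinM lee_fin mulr_ge0.
rewrite -EFinM lee_fin indicE; have [|_] := boolP (w \in G).
  by rewrite inE mulr1; exact: cf.
by rewrite mulr0.
Qed.
End Success.

Lemma local_search_ge0 (R : realType) n k (H : cube n -> R) M s out :
  0 <= local_search k H M s out.
Proof.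
elim: M s => [|M IH] s /=; first by rewrite ler0n.
by apply: sumr_ge0 => s' _; rewrite mulr_ge0// invr_ge0.
Qed.

(** * Reduction to a deterministic statement about each pair of signal and noise *)

Section Planted.
Context d (Omega : measurableType d) (R : realType) (P : probability Omega R).
Variables (n r k M : nat) (gamma lambda : R).
Variables (theta sigma0 : Omega -> cube n) (W : midx r n -> {RV P >-> R}).
Hypothesis model : planted_model k theta W.
Variable good0 : cube n -> cube n -> Prop.
Hypothesis init : {ae P, forall w, good0 (theta w) (sigma0 w)}.
Variables (J : finType) (c : cube n -> J -> midx r n -> R).
Variables (u V b : cube n -> J -> R).
Hypotheses (u_ge0 : forall v j, v \in sparse n k -> 0 <= u v j)
  (V_gt0 : forall v j, v \in sparse n k -> 0 < V v j)
  (cV : forall v j, v \in sparse n k -> \sum_t c v j t ^+ 2 <= V v j)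
  (ub : forall v j, v \in sparse n k ->
     expR (- (u v j ^+ 2 / (2 * V v j))) <= b v j)
  (sumb : forall v, v \in sparse n k -> \sum_j b v j <= 24^-1).
Hypothesis success : forall (v s : cube n) (X : midx r n -> R),
  v \in sparse n k -> good0 v s ->
  (forall j, `|\sum_t c v j t * X t| <= u v j) ->
  11 / 12 <= local_search k
    (search_objective gamma (observation k lambda v X)) M s v.

(** Given [theta = v], some noise bound fails with probability at most [2 * 24^-1 = 1/12]; the two
    comes from the two-sided tail. Summing over [v], the good event has probability at least 11/12,
    and on it the search succeeds with probability at least 11/12. Finally [(11/12)^2 >= 2/3]. *)
Lemma success_probability_ge :
  ((2 / 3)%:E <= success_probability k M gamma lambda theta sigma0 W)%E.
Proof.
case: model => mtheta utheta Wn Wi.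
pose T v := theta @^-1` [set v].
have mT v : measurable (T v) by exact: mtheta.
pose U v := [set w | exists j, (u v j < `|\sum_t c v j t * W t w|)%R].
(* For [v] outside [sparse n k] the whole event [theta = v] is discarded; it is null by uniformity,
   and avoiding it makes [theta w] sparse. *)
pose E v := if v \in sparse n k then T v `&` U v else T v.
have mE v : measurable (E v).
  rewrite /E; case: ifP => // _.
  rewrite (_ : _ `&` _ =
    [set w | exists j, (T v `&` [set w | (u v j < `|\sum_t c v j t * W t w|)%R]) w]).
    by apply: measurable_set_exists => j; exact: measurable_gaussian_tail.
  by apply/seteqP; split=> w /= [] => [Aw [j uj]|j [Aw uj]]; [exists j|split=> //; exists j].
have PE v : (P (E v) <= P (T v) * (12^-1)%:E)%E.
  rewrite /E; case: ifP => vk.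
    apply: le_trans (@gaussian_union_bound _ _ _ _ _ W (T v) (mT v) Wn _ J (c v)
      (u v) (V v) (b v) _ _ _ _) _; rewrite -?/(U v).
    - by move=> B mB; exact: Wi.
    - by move=> j; exact: u_ge0.
    - by move=> j; exact: V_gt0.
    - by move=> j; exact: cV.
    - by move=> j; exact: ub.
    rewrite lee_wpmul2l// lee_fin; have := sumb vk; lra.
  by rewrite (utheta v) vk mul0e.
have PT : (\sum_v P (T v) <= 1)%E.
  under eq_bigr do rewrite (utheta _).
  rewrite sumEFin lee_fin -big_mkcond /= sumr_const.
  have [->|s0] := eqVneq #|sparse n k| 0%N; first by rewrite mulr0n.
  by rewrite -(mulr_natl (_^-1)) divff// pnatr_eq0.
have [N [mN N0 initN]] := init.
pose G := ~` ([set w | exists v, E v w] `|` N).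
have mB : measurable ([set w | exists v, E v w] `|` N).
  by apply: measurableU => //; exact: measurable_set_exists.
have PB : (P ([set w | exists v, E v w] `|` N) <= (12^-1)%:E)%E.
  have mS := measurable_set_exists mE.
  have := measureU2 P mS mN; rewrite [X in (_ + X)%E]N0 adde0 => /le_trans; apply.
  apply: le_trans (measure_set_exists_le _ mE) _.
  apply: (@le_trans _ _ (\sum_v P (T v) * (12^-1)%:E)%E); first exact: lee_sum.
  rewrite -ge0_sume_distrl; last by [].
  by rewrite -[leRHS]mul1e lee_wpmul2r.
have PG : ((11 / 12)%:E <= P G)%E.
  rewrite /G probability_setC//.
  apply: (@le_trans _ _ (1 - (12^-1)%:E)%E); last exact: leeB.
  by rewrite -EFinB lee_fin; lra.
apply: (@le_trans _ _ ((11 / 12)%:E * P G)%E).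
  apply: (@le_trans _ _ ((11 / 12)%:E * (11 / 12)%:E)%E).
    by rewrite -EFinM lee_fin; lra.
  by rewrite lee_wpmul2l// lee_fin; lra.
have c0 : 0 <= 11 / 12 :> R by lra.
apply: expectation_ge => //.
- exact: measurableC.
- by move=> w; exact: local_search_ge0.
move=> w nB.
have nE : ~ E (theta w) w by move=> Ew; apply: nB; left; exists (theta w).
have thk : theta w \in sparse n k.
  by apply/negPn/negP => /negPf tk; apply: nE; rewrite /E tk.
apply: success => //.
  by apply: contrapT => ng; apply: nB; right; exact: initN.
move=> j; rewrite leNgt; apply/negP => uj; apply: nE; rewrite /E thk.
by split => //; exists j.
Qed.
End Planted.

(** * Single-coordinate flips and neighbourhoods *)

Section Flip.
Variable n : nat.
Implicit Types s : cube n.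

Definition flip s (i : 'I_n) : cube n := [ffun j => (j == i) (+) s j].

Lemma flipK i : involutive (flip^~ i).
Proof. by move=> s; apply/ffunP => j; rewrite !ffunE addbA addbb. Qed.

Lemma flip_inj s : injective (flip s).
Proof.
move=> i j /ffunP /(_ i); rewrite !ffunE eqxx.
by have [//|_] := eqVneq i j; case: (s i).
Qed.

Lemma hamming_flip s i : hamming s (flip s i) = 1%N.
Proof.
rewrite /hamming (eq_card (B := pred1 i)) ?card1// => j.
by rewrite !inE ffunE; case: (j == i); case: (s j).
Qed.

Lemma hamming1_flip s s' : hamming s s' = 1%N -> exists i, s' = flip s i.
Proof.
rewrite /hamming => h; have /card1P[i hi] : #|[pred i | s i != s' i]| == 1%N by apply/eqP.
exists i; apply/ffunP => j; rewrite ffunE; have := hi j; rewrite !inE.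
by case: (j == i); case: (s j); case: (s' j).
Qed.

Lemma nnz_sum s : nnz s = (\sum_i s i)%N.
Proof. by rewrite /nnz -sum1_card big_mkcond; apply: eq_bigr => i _; rewrite inE; case: (s i). Qed.

Lemma nnz_flip0 s i : ~~ s i -> nnz (flip s i) = (nnz s).+1.
Proof.
move=> si; rewrite !nnz_sum (bigD1 i)//= [in RHS](bigD1 i)//= ffunE eqxx (negPf si) /=.
rewrite add0n add1n; congr (_.+1); apply: eq_bigr => j /negPf ji.
by rewrite ffunE ji.
Qed.

Lemma nnz_flip1 s i : s i -> nnz s = (nnz (flip s i)).+1.
Proof. by move=> si; rewrite -[in LHS](flipK i s) nnz_flip0// ffunE eqxx si. Qed.

Lemma card_neighbours (R : realType) k s : (#|neighbours R k s| <= n)%N.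
Proof.
apply: (@leq_trans #|[set flip s i | i : 'I_n]|).
  apply/subset_leq_card/fintype.subsetP => s'; rewrite inE => /andP[/eqP/hamming1_flip[i ->] _].
  exact: imset_f.
by rewrite -[leqRHS]card_ord; exact: leq_imset_card.
Qed.
End Flip.

(** * Hitting time of [theta] under a drift condition *)

Section Hitting.
Variables (R : realType) (n k : nat) (H H' : cube n -> R) (theta : cube n).
Variables (I : cube n -> Prop) (kappa hmax : R).
Hypothesis kappa0 : 0 <= kappa.
Hypothesis same_move : forall s s', I s -> s' \in neighbours R k s ->
  local_move H s s' = local_move H' s s'.
Hypothesis I_move : forall s s', I s -> s' \in neighbours R k s ->
  I (local_move H' s s').
Hypothesis I_nbhs : forall s, I s -> (0 < #|neighbours R k s|)%N.
Hypothesis I_hmax : forall s, I s -> H' s <= hmax.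
Hypothesis drift : forall s, I s -> s != theta ->
  kappa <= \sum_(s' in neighbours R k s) Num.max 0 (H' s' - H' s).
Hypothesis absorbing : forall s', I theta -> s' \in neighbours R k theta ->
  local_move H' theta s' = theta.

Lemma local_moveE s s' : H' (local_move H' s s') = H' s + Num.max 0 (H' s' - H' s).
Proof.
rewrite /local_move; case: ltP => h; last by rewrite addr0.
by rewrite addrC subrK.
Qed.

Lemma avg_cst s (x : R) : I s ->
  \sum_(s' in neighbours R k s) #|neighbours R k s|%:R^-1 * x = x.
Proof.
move=> Is; rewrite -mulr_suml sumr_const -(mulr_natl (_^-1)) mulfV ?mul1r// pnatr_eq0.
by rewrite -lt0n I_nbhs.
Qed.

Lemma local_search_absorbing M : I theta -> local_search k H M theta theta = 1.
Proof.
move=> It; elim: M => [|M IH] /=; first by rewrite eqxx.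
rewrite -[RHS](avg_cst 1 It); apply: eq_bigr => s' Ns'.
by rewrite same_move// absorbing// IH.
Qed.

(* One step raises [H'] by at least [kappa / n] on average until [theta] is
   reached; since H' <= hmax the expected hitting time is at most
   [n * (hmax - H' s) / kappa]. *)
Lemma local_search_failure M s : I s ->
  M%:R * kappa * (1 - local_search k H M s theta) <= n%:R * (hmax - H' s).
Proof.
elim: M s => [|M IH] s Is.
  by rewrite !mul0r mulr_ge0// subr_ge0 I_hmax.
have [st|st] := eqVneq s theta.
  rewrite st local_search_absorbing -?st// subrr mulr0 mulr_ge0// subr_ge0.
  by rewrite I_hmax.
set N := neighbours R k s; set w : R := #|N|%:R^-1.
have w0 : 0 <= w by rewrite invr_ge0.
have N0 : 0 < #|N|%:R :> R by rewrite ltr0n I_nbhs.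
have f0 : 0 <= local_search k H M.+1 s theta by exact: local_search_ge0.
have eqf : local_search k H M.+1 s theta =
    \sum_(s' in N) w * local_search k H M (local_move H' s s') theta.
  by rewrite /=; apply: eq_bigr => s' Ns'; rewrite same_move.
have step : M%:R * kappa * (1 - local_search k H M.+1 s theta) <=
    \sum_(s' in N) w * (n%:R * (hmax - H' (local_move H' s s'))).
  rewrite eqf -[X in X - _](avg_cst 1 Is) -sumrB mulr_sumr; apply: ler_sum => s' Ns'.
  rewrite -/N -/w -mulrBr mulrCA; apply: ler_wpM2l => //.
  by apply: IH; exact: I_move.
have eqH : \sum_(s' in N) w * (n%:R * (hmax - H' (local_move H' s s'))) =
    n%:R * (hmax - H' s) - n%:R * w * \sum_(s' in N) Num.max 0 (H' s' - H' s).
  rewrite -{1}(avg_cst (n%:R * (hmax - H' s)) Is) mulr_sumr -sumrB.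
  by apply: eq_bigr => s' _; rewrite local_moveE -/N -/w; ring.
(* The constraint on the support size can only shrink the neighbourhood below [n] elements, so a
   uniform draw has weight at least [1/n]. *)
have nw : 1 <= n%:R * w by rewrite /w ler_pdivlMr// mul1r ler_nat card_neighbours.
have gain : kappa <= n%:R * w * \sum_(s' in N) Num.max 0 (H' s' - H' s).
  by apply: le_trans (drift Is st) _; rewrite ler_peMl ?(le_trans kappa0 (drift Is st)).
(* The first [M] iterations are covered by the averaged induction hypothesis [step]; the additional
   one costs at most [kappa], which [gain] pays. *)
rewrite -natr1 mulrDl mul1r mulrDl.
have : kappa * (1 - local_search k H M.+1 s theta) <= kappa by rewrite ler_piMr//; lra.
lra.
Qed.
End Hitting.
Lemma card_pred_sum (T : finType) (p : pred T) : #|p| = (\sum_i p i)%N.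
Proof.
by rewrite -sum1_card big_mkcond; apply: eq_bigr => i _; rewrite unfold_in; case: (p i).
Qed.

(** * Deterministic analysis of the objective and of its truncation *)

Section Landscape.
Variables (R : realType) (n q k : nat) (theta : cube n).
Variables (X : cube n -> R) (pen : nat -> R).
Variables (rho S K kappa A g q1 q2 C0 : R).

Definition overlap (s : cube n) : nat := #|[pred i | s i && theta i]|.
Definition bad (s : cube n) : pred 'I_n := [pred i | s i && ~~ theta i].
Definition missing (s : cube n) : pred 'I_n := [pred i | ~~ s i && theta i].

(** Here [q.+1] is the tensor order. The case [rho' = rho] is the search objective, the case
    [rho' = S] the truncated energy that measures progress. *)
Definition energy (rho' : R) (s : cube n) : R :=
  rho' * (overlap s)%:R ^+ q.+1 + X s - pen (nnz s).

(** The overlap stays above [x0], half of the initial guarantee [k / 8]. The factor 16 in [Q]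
    cancels the one in [x0]. *)
Let Q : R := 16 * (1 + 2 * A + q1 + q2).
Let x0 : R := k%:R / 16.

Hypothesis theta_k : nnz theta = k.
Hypotheses (k_ge2 : (2 <= k)%N) (K1 : 1 <= K) (kappa0 : 0 < kappa).
Hypotheses (A0 : 0 <= A) (q10 : 0 <= q1) (q20 : 0 <= q2) (gA : 2 * A + 1 <= g).
Hypothesis X_sum : forall s (D : pred 'I_n), (2 * nnz s <= 3 * k)%N -> s != theta ->
  D = bad s \/ D = missing s ->
  `|\sum_(i | D i) (X (flip s i) - X s)| <= A * (hamming s theta)%:R * kappa.
Hypothesis X_max : forall s, (2 * nnz s <= 3 * k)%N -> `|X s| <= A * k%:R * kappa.
Hypothesis X_lip : forall s i, (2 * nnz s <= 3 * k)%N ->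
  `|X (flip s i) - X s| <= A * K * kappa.
Hypothesis pen_incr_le : forall s, (s.+1 <= 2 * k)%N -> pen s.+1 - pen s <= q1 * kappa.
Hypothesis pen_incr_ge : forall s, (k <= s)%N -> g * kappa <= pen s.+1 - pen s.
Hypothesis pen_ge0 : forall s, 0 <= pen s.
Hypothesis pen_le : forall s, (s <= 2 * k)%N -> pen s <= q2 * k%:R * kappa.
Hypotheses (S0 : 0 <= S) (S_rho : S <= rho).
Hypothesis S_ge : Q * kappa <= S * x0 ^+ q.
Hypothesis S_le : S * k%:R ^+ q <= C0 * K * kappa.
Hypothesis S_eq : S = rho \/ Q * K * kappa <= S * x0 ^+ q.

Lemma mem_neighbours (s : cube n) i :
  (flip s i \in neighbours R k s) = (2 * nnz (flip s i) <= 3 * k)%N.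
Proof.
rewrite inE hamming_flip eqxx /= -(ler_nat R) !natrM.
by apply/idP/idP => h; lra.
Qed.

Lemma neighbours_flip (s s' : cube n) : s' \in neighbours R k s ->
  exists2 i, s' = flip s i & (2 * nnz (flip s i) <= 3 * k)%N.
Proof.
move=> Ns'; move: (Ns'); rewrite inE => /andP[/eqP/hamming1_flip[i si] _].
by exists i => //; rewrite -mem_neighbours -si.
Qed.

Lemma nnz_overlap (s : cube n) : nnz s = (overlap s + #|bad s|)%N.
Proof.
rewrite /nnz /overlap /bad !card_pred_sum -big_split /=.
by apply: eq_bigr => i _; case: (s i); case: (theta i).
Qed.

Lemma k_overlap (s : cube n) : k = (overlap s + #|missing s|)%N.
Proof.
rewrite -theta_k /nnz /overlap /missing !card_pred_sum -big_split /=.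
by apply: eq_bigr => i _; case: (s i); case: (theta i).
Qed.

Lemma hamming_bad_missing (s : cube n) : hamming s theta = (#|bad s| + #|missing s|)%N.
Proof.
rewrite /hamming /bad /missing !card_pred_sum -big_split /=.
by apply: eq_bigr => i _; case: (s i); case: (theta i).
Qed.

Lemma overlap_sum (s : cube n) : overlap s = (\sum_i (s i && theta i))%N.
Proof. by rewrite /overlap card_pred_sum. Qed.

Lemma overlap_flipN (s : cube n) i : ~~ theta i -> overlap (flip s i) = overlap s.
Proof.
move=> ti; rewrite !overlap_sum; apply: eq_bigr => j _; rewrite ffunE.
by have [->|//] := eqVneq j i; rewrite (negPf ti) !andbF.
Qed.

Lemma overlap_flip0 (s : cube n) i : theta i -> ~~ s i -> overlap (flip s i) = (overlap s).+1.
Proof.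
move=> ti si; rewrite !overlap_sum (bigD1 i)//= [in RHS](bigD1 i)//= ffunE eqxx.
rewrite (negPf si) ti /= add0n add1n; congr (_.+1); apply: eq_bigr => j /negPf ji.
by rewrite ffunE ji.
Qed.

Lemma overlap_flip1 (s : cube n) i : theta i -> s i -> overlap s = (overlap (flip s i)).+1.
Proof.
by move=> ti si; rewrite -[in LHS](flipK i s) overlap_flip0// ffunE eqxx si.
Qed.

(** Discrete derivative of the signal, in terms of the smaller overlap; used when a coordinate of
    [theta] is added. The primed variant uses the larger overlap and serves for removals. *)
Lemma expr_succ_ge (x : R) : 0 <= x -> x ^+ q <= (x + 1) ^+ q.+1 - x ^+ q.+1.
Proof.
move=> x_ge0; have h : x ^+ q <= (x + 1) ^+ q by rewrite lerXn2r ?nnegrE//; lra.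
rewrite !exprS; have : (x + 1) * x ^+ q <= (x + 1) * (x + 1) ^+ q.
  by rewrite ler_wpM2l//; lra.
lra.
Qed.

Lemma expr_succ_ge' (x : R) : 0 <= x -> (x + 1) ^+ q <= (x + 1) ^+ q.+1 - x ^+ q.+1.
Proof.
move=> x_ge0; have h : x ^+ q <= (x + 1) ^+ q by rewrite lerXn2r ?nnegrE//; lra.
rewrite !exprS; have : x * x ^+ q <= x * (x + 1) ^+ q by rewrite ler_wpM2l.
lra.
Qed.

Let Q_ge : 1 + 2 * A + q1 + q2 <= Q.
Proof. by move: A0 q10 q20; rewrite /Q; lra. Qed.
Ltac slra := move: (A0) (q10) (q20) (gA) (K1) (kappa0) (Q_ge) => ? ? ? ? ? ? ?; lra.

Let x00 : 0 < x0.
Proof. by rewrite divr_gt0// ltr0n (ltn_trans _ k_ge2). Qed.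
Let S_gt0 : 0 < S.
Proof.
rewrite lt_neqAle S0 andbT; apply/eqP => S_eq0.
have := S_ge; rewrite -S_eq0 mul0r; have : 0 < Q * kappa by rewrite mulr_gt0//; slra.
slra.
Qed.

(** [D] is the larger of the missing and the bad set. It holds at least half of the wrong
    coordinates, so the noise costs at most [2 * A * kappa] per flip, while signal or penalty earns
    at least [(1 + 2 * A) * kappa]. *)
Lemma drift_set (s : cube n) : (2 * nnz s <= 3 * k)%N -> x0 <= (overlap s)%:R -> s != theta ->
  exists D : pred 'I_n, [/\ (forall i, D i -> s i != theta i),
    (forall i, D i -> flip s i \in neighbours R k s) &
    kappa <= \sum_(i | D i) (energy S (flip s i) - energy S s)].
Proof.
move=> s3k xa st.
have m0 : (0 < hamming s theta)%N.
  rewrite lt0n; apply: contraNneq st => /card0_eq h.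
  by apply/eqP/ffunP => i; have := h i; rewrite !inE => /negbFE/eqP.
have hE := hamming_bad_missing s; have sE := nnz_overlap s; have kE := k_overlap s.
(* The comparison is equivalent to [nnz s <= k]. In the first case one more coordinate fits under
   [3k/2], as [k >= 2]; in the second, removals end at size at least [k], where the penalty
   increments are at least [g * kappa]. *)
have [be|eb] := leqP #|bad s| #|missing s|.
  exists (missing s); split.
  - by move=> i /andP[si ti]; rewrite ti (negPf si).
  - move=> i /andP[si ti]; rewrite mem_neighbours nnz_flip0//.
    by move: sE kE be k_ge2; clear; lia.
  have := X_sum s3k st (or_intror erefl); rewrite ler_norml => /andP[lX _].
  have s_lt2k : ((nnz s).+1 <= 2 * k)%N.
    by move: sE kE be k_ge2; clear; lia.
  have lb : #|missing s|%:R * ((Q - q1) * kappa) +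
      \sum_(i | missing s i) (X (flip s i) - X s) <=
      \sum_(i | missing s i) (energy S (flip s i) - energy S s).
    rewrite mulr_natl -sumr_const -big_split /=; apply: ler_sum => i /andP[si ti].
    rewrite /energy overlap_flip0// nnz_flip0//.
    have pi := pen_incr_le (s_lt2k : ((nnz s).+1 <= 2 * k)%N).
    have ei := expr_succ_ge (ler0n R (overlap s)).
    have : S * x0 ^+ q <= S * ((overlap s).+1%:R ^+ q.+1 - (overlap s)%:R ^+ q.+1).
      apply: ler_wpM2l => //; rewrite -natr1; apply: le_trans ei.
      by rewrite lerXn2r ?nnegrE ?(ltW x00).
    rewrite mulrBr mulrBl; have := S_ge; slra.
  apply: le_trans lb.
  have e1 : 1 <= #|missing s|%:R :> R.
    by rewrite ler1n; move: m0 hE be; clear; lia.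
  have hb : (hamming s theta)%:R <= 2 * #|missing s|%:R :> R.
    by rewrite -natrM ler_nat; move: hE be; clear; lia.
  have h1 : A * (hamming s theta)%:R * kappa <= A * (2 * #|missing s|%:R) * kappa.
    by rewrite ler_wpM2r ?(ltW kappa0)// ler_wpM2l.
  have h2 : #|missing s|%:R * ((1 + 2 * A) * kappa) <= #|missing s|%:R * ((Q - q1) * kappa).
    by rewrite ler_wpM2l// ler_wpM2r ?(ltW kappa0)//; slra.
  have h3 : kappa <= #|missing s|%:R * kappa by rewrite ler_peMl// ltW.
  slra.
exists (bad s); split.
- by move=> i /andP[si ti]; rewrite si (negPf ti).
- by move=> i /andP[si ti]; rewrite mem_neighbours; move: (nnz_flip1 si) s3k; clear; lia.
have := X_sum s3k st (or_introl erefl); rewrite ler_norml => /andP[lX _].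
have lb : #|bad s|%:R * (g * kappa) + \sum_(i | bad s i) (X (flip s i) - X s) <=
    \sum_(i | bad s i) (energy S (flip s i) - energy S s).
  rewrite mulr_natl -sumr_const -big_split /=; apply: ler_sum => i /andP[si ti].
  rewrite /energy overlap_flipN// (nnz_flip1 si).
  have /pen_incr_ge : (k <= nnz (flip s i))%N.
    by move: (nnz_flip1 si) sE kE eb; clear; lia.
  slra.
apply: le_trans lb.
have e1 : 1 <= #|bad s|%:R :> R by rewrite ler1n; move: eb; clear; lia.
have hb : (hamming s theta)%:R <= 2 * #|bad s|%:R :> R.
  by rewrite -natrM ler_nat; move: hE eb; clear; lia.
have h1 : A * (hamming s theta)%:R * kappa <= A * (2 * #|bad s|%:R) * kappa.
  by rewrite ler_wpM2r ?(ltW kappa0)// ler_wpM2l.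
have h2 : #|bad s|%:R * ((1 + 2 * A) * kappa) <= #|bad s|%:R * (g * kappa).
  by rewrite ler_wpM2l// ler_wpM2r ?(ltW kappa0)//; slra.
have h3 : kappa <= #|bad s|%:R * kappa by rewrite ler_peMl// ltW.
slra.
Qed.

(* The lower bound on the energy is preserved by the moves, whereas the overlap
   with theta itself may decrease. *)
Definition region (s : cube n) : Prop := (2 * nnz s <= 3 * k)%N /\
  S * (k%:R / 8) ^+ q.+1 - (A + q2) * k%:R * kappa <= energy S s.

(** Since [k / 8 = 2 * x0], the floor in [region] is at least
    [2 * S * x0^(q+1) - (A + q2) * k * kappa], whereas an overlap below [x0] gives energy at most
    [S * x0^(q+1) + A * k * kappa]. By [S_ge] these are incompatible. *)
Lemma region_overlap s : region s -> x0 <= (overlap s)%:R.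
Proof.
case=> s3k hs; rewrite leNgt; apply/negP => ax.
have : S * (overlap s)%:R ^+ q.+1 <= S * x0 ^+ q.+1.
  by rewrite ler_wpM2l// lerXn2r ?nnegrE ?(ltW x00) ?(ltW ax).
have := X_max s3k; rewrite ler_norml => /andP[_ uX]; have := pen_ge0 (nnz s).
have k8 : k%:R / 8 = 2 * x0 by rewrite /x0; field.
move: hs; rewrite k8 /energy exprMn => hs p0 hS.
have e2 : 2 <= 2 ^+ q.+1 :> R by rewrite -natrX ler_nat -{1}(expn1 2) leq_exp2l.
have h2 : 2 * (S * x0 ^+ q.+1) <= S * (2 ^+ q.+1 * x0 ^+ q.+1).
  by rewrite mulrCA ler_wpM2l// ler_wpM2r// exprn_ge0// ltW.
have h3 : Q * kappa * x0 <= S * x0 ^+ q.+1.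
  by rewrite exprSr mulrA ler_wpM2r ?(ltW x00).
have kk : 0 < k%:R * kappa by rewrite mulr_gt0// ltr0n (ltn_trans _ k_ge2).
have : (1 + 2 * A + q1 + q2) * (k%:R * kappa) <= S * x0 ^+ q.+1.
  by apply: le_trans h3; rewrite /Q /x0; slra.
have : (2 * A + q2) * (k%:R * kappa) < (1 + 2 * A + q1 + q2) * (k%:R * kappa).
  by rewrite ltr_pM2r//; slra.
slra.
Qed.

(** A flip outside [theta] keeps the overlap, so the signal strength cancels. If [S] differs from
    [rho], then by [S_eq] the signal outweighs noise and penalty in any flip inside [theta]: both
    energies accept additions and refuse removals. *)
Lemma region_same_move s s' : region s -> s' \in neighbours R k s ->
  local_move (energy rho) s s' = local_move (energy S) s s'.
Proof.
move=> Is Ns'; have xa := region_overlap Is; have [s3k _] := Is.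
have [i si s'3k] := neighbours_flip Ns'; subst s'.
case: S_eq => [->//|SQ].
have xaq : S * x0 ^+ q <= S * (overlap s)%:R ^+ q.
  by rewrite ler_wpM2l// lerXn2r ?nnegrE ?(ltW x00).
have QK : (1 + 2 * A + q1 + q2) * (K * kappa) <= S * (overlap s)%:R ^+ q.
  apply: le_trans xaq; apply: le_trans SQ; rewrite -mulrA ler_wpM2r//.
  by rewrite mulr_ge0 ?(ltW kappa0)//; slra.
have Kk : 0 < K * kappa by rewrite mulr_gt0//; slra.
have kK : q1 * kappa <= q1 * (K * kappa).
  by rewrite ler_wpM2l// ler_peMl// ltW.
have AK : (A + q1) * (K * kappa) < (1 + 2 * A + q1 + q2) * (K * kappa).
  by rewrite ltr_pM2r//; slra.
have := @X_lip s i s3k; rewrite ler_norml => /andP[lX uX].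
rewrite /local_move; congr (if _ then _ else _).
have [ti|ti] := boolP (theta i); last first.
  by rewrite /energy overlap_flipN//; congr (0 < _); ring.
have [si|si] := boolP (s i).
  have oE := overlap_flip1 ti si; have nE := nnz_flip1 si.
  have pi : pen (nnz (flip s i)).+1 - pen (nnz (flip s i)) <= q1 * kappa.
    by apply: pen_incr_le; move: nE s3k k_ge2; clear; lia.
  have neg rho' : S <= rho' -> (0 < energy rho' (flip s i) - energy rho' s) = false.
    move=> Sr; apply/negbTE; rewrite -leNgt /energy nE oE.
    have ei := expr_succ_ge' (ler0n R (overlap (flip s i))).
    rewrite natr1 in ei.
    have : S * (overlap s)%:R ^+ q <= rho' *
        ((overlap (flip s i)).+1%:R ^+ q.+1 - (overlap (flip s i))%:R ^+ q.+1).
      by rewrite -oE in ei *; apply: ler_pM => //; rewrite exprn_ge0.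
    rewrite mulrBr; slra.
  by rewrite !neg.
have oE := overlap_flip0 ti si; have nE := nnz_flip0 si.
have pi : pen (nnz s).+1 - pen (nnz s) <= q1 * kappa.
  by apply: pen_incr_le; rewrite nE in s'3k; move: s'3k k_ge2; clear; lia.
have pos rho' : S <= rho' -> 0 < energy rho' (flip s i) - energy rho' s.
  move=> Sr; rewrite /energy nE oE.
  have ei := expr_succ_ge (ler0n R (overlap s)); rewrite natr1 in ei.
  have : S * (overlap s)%:R ^+ q <=
      rho' * ((overlap s).+1%:R ^+ q.+1 - (overlap s)%:R ^+ q.+1).
    by apply: ler_pM => //; rewrite exprn_ge0.
  rewrite mulrBr; slra.
by rewrite !pos.
Qed.

Lemma region_move s s' : region s -> s' \in neighbours R k s ->
  region (local_move (energy S) s s').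
Proof.
move=> [s3k hs] Ns'; split; last first.
  by rewrite local_moveE; apply: le_trans hs _; rewrite lerDl le_max lexx.
by rewrite /local_move; case: ifP => // _; have [i -> ] := neighbours_flip Ns'.
Qed.

Lemma region_nbhs s : region s -> (0 < #|neighbours R k s|)%N.
Proof.
move=> Is; have xa := region_overlap Is; have [s3k _] := Is.
have : (0 < overlap s)%N by rewrite -(ltr0n R); exact: lt_le_trans xa.
case/card_gt0P => i; rewrite inE => /andP[si ti].
by apply/card_gt0P; exists (flip s i); rewrite mem_neighbours; move: (nnz_flip1 si) s3k; clear; lia.
Qed.

Lemma region_hmax s : region s -> energy S s <= (C0 * K + A) * k%:R * kappa.
Proof.
case=> s3k _; have := X_max s3k; rewrite ler_norml => /andP[_ uX].
have p0 := pen_ge0 (nnz s).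
have ak : (overlap s)%:R <= k%:R :> R by rewrite ler_nat (k_overlap s) leq_addr.
have : S * (overlap s)%:R ^+ q.+1 <= S * k%:R ^+ q.+1.
  by rewrite ler_wpM2l// lerXn2r ?nnegrE.
have : S * k%:R ^+ q.+1 <= C0 * K * kappa * k%:R by rewrite exprSr mulrA ler_wpM2r.
rewrite /energy; slra.
Qed.

Lemma region_drift s : region s -> s != theta ->
  kappa <= \sum_(s' in neighbours R k s) Num.max 0 (energy S s' - energy S s).
Proof.
move=> Is st; have xa := region_overlap Is; have [s3k _] := Is.
have [D [_ DN le]] := drift_set s3k xa st; apply: le_trans le _.
apply: (@le_trans _ _ (\sum_(i | D i) Num.max 0 (energy S (flip s i) - energy S s))).
  by apply: ler_sum => i _; rewrite le_max lexx orbT.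
(* As [flip s] is injective, the sum over [D] is a subsum of the one over the neighbours; the
   remaining terms are nonnegative. *)
pose Ds : {set 'I_n} := [set i | D i]%SET.
rewrite (eq_bigl (mem Ds)); last by move=> i; rewrite /= inE.
rewrite -(big_imset (fun s' => Num.max 0 (energy S s' - energy S s)) (h := flip s) (A := mem Ds)) /=.
  rewrite [leRHS](bigID (mem [set flip s i | i in Ds]%SET)) /=.
  rewrite -[leLHS]addr0 lerD//; last by apply: sumr_ge0 => s' _; rewrite le_max lexx.
  rewrite le_eqVlt; apply/orP; left; apply/eqP/eq_bigl => s'.
  rewrite andb_idl// => /finset.imsetP[i]; rewrite inE => Di ->; exact: DN.
by move=> i j _ _; exact: flip_inj.
Qed.

(** [drift_set] is applied at [flip theta i]. Its only wrong coordinate is [i], so the positive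
    total gain must come from flipping back; hence leaving [theta] lowers the energy. *)
Lemma region_absorbing s' : region theta -> s' \in neighbours R k theta ->
  local_move (energy S) theta s' = theta.
Proof.
move=> It Ns'; have [i si s'3k] := neighbours_flip Ns'; subst s'.
rewrite /local_move; case: ifP => // gt0.
have st : flip theta i != theta.
  by apply/eqP => /ffunP/(_ i); rewrite ffunE eqxx; case: (theta i).
(* The overlap is at least [k - 1], which exceeds [k / 16] because [k >= 2]. *)
have xa : x0 <= (overlap (flip theta i))%:R.
  have : (k <= (overlap (flip theta i)).+1)%N.
    have [ti|ti] := boolP (theta i).
      by rewrite -overlap_flip1// -theta_k /nnz /overlap; apply: eq_leq; apply: eq_card => j; rewrite !inE andbb.
    by rewrite overlap_flipN// -theta_k /nnz /overlap; apply: leqW; apply: eq_leq; apply: eq_card => j; rewrite !inE andbb.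
  rewrite -(ler_nat R) -natr1 /x0; have : 2 <= k%:R :> R by rewrite ler_nat.
  slra.
have [D [Dne _]] := drift_set s'3k xa st.
have Di j : D j -> j = i.
  move=> /Dne; rewrite ffunE; have [//|_] := eqVneq j i.
  by rewrite /= eqxx.
have [Dii|Dii] := boolP (D i).
  rewrite (bigD1 i)//= big_pred0.
    by rewrite addr0 (flipK i theta : flip (flip theta i) i = theta) => ?; exfalso; slra.
  by move=> j; apply/negbTE; rewrite negb_and negbK; have [/Di->|//] := boolP (D j); rewrite eqxx orbT.
rewrite big_pred0; first by move=> ?; exfalso; slra.
by move=> j; apply/negbTE; apply: contraNN Dii => Dj; rewrite -(Di j Dj).
Qed.

(** The start lies in [region], and its energy is within [(C0 + 2 * A + q2) * k * K * kappa] of the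
    maximum. With [M] at least [12 * n] times this gap over [kappa], [local_search_failure] bounds
    the failure probability by 1/12. *)
Lemma landscape_local_search (M : nat) (s : cube n) :
  (0 < n)%N -> (2 * nnz s <= 3 * k)%N -> (k <= 8 * overlap s)%N ->
  12 * (C0 + 2 * A + q2) * n%:R * k%:R * K <= M%:R ->
  11 / 12 <= local_search k (energy rho) M s theta.
Proof.
move=> n0 s3k ks leM.
have := X_max s3k; rewrite ler_norml => /andP[lX _].
have ps : pen (nnz s) <= q2 * k%:R * kappa.
  by apply: pen_le; move: s3k; clear; lia.
have Is : region s.
  split=> //; rewrite /energy.
  have : S * (k%:R / 8) ^+ q.+1 <= S * (overlap s)%:R ^+ q.+1.
    rewrite ler_wpM2l// lerXn2r ?nnegrE ?divr_ge0//.
    by rewrite ler_pdivrMr// mulrC -natrM ler_nat.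
  slra.
have := local_search_failure (ltW kappa0) region_same_move region_move region_nbhs
  region_hmax region_drift region_absorbing M Is.
set f := local_search _ _ _ _ _ => fail.
have k0 : 0 < k%:R :> R by rewrite ltr0n (ltn_trans _ k_ge2).
have nR0 : 0 < n%:R :> R by rewrite ltr0n.
have gap : (C0 * K + A) * k%:R * kappa - energy S s <= (C0 + 2 * A + q2) * (k%:R * K * kappa).
  have : 0 <= S * (overlap s)%:R ^+ q.+1 by rewrite mulr_ge0// exprn_ge0.
  have : (2 * A + q2) * (k%:R * kappa) <= (2 * A + q2) * (k%:R * K * kappa).
    rewrite ler_wpM2l//; first by slra.
    by rewrite mulrAC ler_peMr// mulr_ge0// ltW.
  rewrite /energy; slra.
have fail' : M%:R * kappa * (1 - f) <= n%:R * ((C0 + 2 * A + q2) * (k%:R * K * kappa)).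
  by apply: le_trans fail _; rewrite ler_wpM2l.
rewrite leNgt; apply/negP => f_lt.
have C00 : 0 < C0.
  have := lt_le_trans (mulr_gt0 S_gt0 (exprn_gt0 q k0)) S_le.
  by rewrite -mulrA pmulr_lgt0// mulr_gt0//; slra.
have B0 : 0 < C0 + 2 * A + q2 by slra.
have : 12 * (C0 + 2 * A + q2) * n%:R * k%:R * K * kappa * (1 - f) <= M%:R * kappa * (1 - f).
  by rewrite ler_wpM2r ?ler_wpM2r ?(ltW kappa0)//; slra.
have : 12 * (C0 + 2 * A + q2) * n%:R * k%:R * K * kappa * 12^-1 < 12 * (C0 + 2 * A + q2) * n%:R * k%:R * K * kappa * (1 - f).
  rewrite ltr_pM2l; first by slra.
  by rewrite !mulr_gt0//; slra.
slra.
Qed.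
End Landscape.

(** * Noise increments as linear forms in the tensor entries, and their variances *)

Section Tensor.
Variables (R : realType) (n r : nat).
Implicit Types (s v : cube n) (W : midx r n -> R) (D : pred 'I_n).

Definition noise W s : R := inner (tpow (rvec R s)) W.

Definition flips_coef s D (t : midx r n) : R :=
  \sum_(i | D i) (tpow (rvec R (flip s i)) t - tpow (rvec R s) t).

Lemma noise_flips W s D :
  \sum_(i | D i) (noise W (flip s i) - noise W s) = \sum_t flips_coef s D t * W t.
Proof.
under [RHS]eq_bigr do rewrite /flips_coef mulr_suml.
rewrite exchange_big /=; apply: eq_bigr => i _.
by rewrite /noise /inner -sumrB; apply: eq_bigr => t _; rewrite mulrBl.
Qed.

Lemma sum_tensor (F : 'I_r -> 'I_n -> R) :
  \sum_(t : midx r n) \prod_j F j (t j) = \prod_j \sum_i F j i.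
Proof. by rewrite bigA_distr_bigA. Qed.

Lemma inner_tpow (x y : 'I_n -> R) :
  inner (@tpow R n r x) (tpow y) = inner x y ^+ r.
Proof.
rewrite /inner -[X in _ ^+ X]card_ord -prodr_const -(sum_tensor (fun _ i => x i * y i)).
by apply: eq_bigr => t _; rewrite /tpow -big_split.
Qed.

Lemma tpow_rvec s (t : midx r n) : tpow (rvec R s) t = [forall j, s (t j)]%:R.
Proof.
rewrite /tpow /rvec; have [/forallP h|] := boolP [forall j, s (t j)].
  by rewrite big1// => j _; rewrite h.
by rewrite negb_forall => /existsP[j /negPf hj]; rewrite (bigD1 j)//= hj mul0r.
Qed.

Lemma sum_rvec s : \sum_i rvec R s i = (nnz s)%:R.
Proof. by rewrite nnz_sum natr_sum. Qed.

Lemma sum_tpow_sqr s : \sum_t @tpow R n r (rvec R s) t ^+ 2 = (nnz s)%:R ^+ r.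
Proof.
transitivity (\sum_t @tpow R n r (rvec R s) t).
  by apply: eq_bigr => t _; rewrite tpow_rvec; case: [forall j, s (t j)]; rewrite ?expr1n ?expr0n.
by rewrite (sum_tensor (fun=> rvec R s)) sum_rvec prodr_const card_ord.
Qed.

Let sup s i : 'I_n -> R := fun x => ((x == i) || s x)%:R.

(** Counts the positions [j] with [t j = i] whose other entries lie in the support of [s] together
    with [i]. Each [t] where flipping [i] changes the tensor power has such a position. *)
Let flip_term s i (t : midx r n) : R :=
  \sum_(j < r) \prod_(l < r) (if l == j then (t l == i)%:R else sup s i (t l)).

Let tpow_flip_le s i (t : midx r n) :
  `|tpow (rvec R (flip s i)) t - tpow (rvec R s) t| <=
  (i \in codom t)%:R /\
  `|tpow (rvec R (flip s i)) t - tpow (rvec R s) t| <= flip_term s i t.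
Proof.
have t0 : 0 <= flip_term s i t.
  apply: sumr_ge0 => j _; apply: prodr_ge0 => l _.
  by case: ifP => _; rewrite ler0n.
rewrite !tpow_rvec.
have [/codomP[j tj]|it] := boolP (i \in codom t); last first.
  have -> : [forall j, flip s i (t j)] = [forall j, s (t j)].
    apply: eq_forallb => j; rewrite ffunE; case: eqP => // tj.
    by case/negP: it; rewrite -tj codom_f.
  by rewrite subrr normr0.
set a := [forall j, flip s i (t j)]; set b := [forall j, s (t j)].
have le1 : `|a%:R - b%:R| <= 1 :> R.
  by case: a; case: b; rewrite ?subrr ?subr0 ?sub0r ?normrN ?normr0 ?normr1.
split => //.
have [ab|nab] := boolP (a || b); last first.
  by move: nab; rewrite negb_or => /andP[/negPf-> /negPf->]; rewrite subrr normr0.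
apply: le_trans le1 _; rewrite /flip_term (bigD1 j)//=.
have -> : \prod_(l < r) (if l == j then (t l == i)%:R else sup s i (t l)) = 1 :> R.
  apply: big1 => l _; case: eqP => [->|_]; first by rewrite tj eqxx.
  rewrite /sup; have [//|tl] := eqVneq (t l) i => /=.
  case/orP: ab => /forallP /(_ l); last by move=> ->.
  by rewrite ffunE (negPf tl) /= => ->.
rewrite lerDl; apply: sumr_ge0 => j' _; apply: prodr_ge0 => l _.
by case: ifP => _; rewrite ler0n.
Qed.

(** One factor of the square is bounded by [r], as at most [r] coordinates occur in [t]; the other
    by the sum of the [flip_term]. There, with [i] and its position fixed, each of the [r - 1] free
    entries has at most [nnz s + 1 <= N] values. *)
Lemma sum_flips_coef_sqr s D (N : nat) : (nnz s < N)%N ->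
  \sum_t flips_coef s D t ^+ 2 <= r%:R ^+ 2 * #|D|%:R * N%:R ^+ r.-1.
Proof.
move=> sN.
have coef_le t : flips_coef s D t ^+ 2 <= r%:R * \sum_(i | D i) flip_term s i t.
  rewrite -real_normK ?num_real// expr2.
  have h1 : `|flips_coef s D t| <= r%:R.
    apply: le_trans (ler_norm_sum _ _ _) _.
    apply: (@le_trans _ _ (\sum_(i | D i) (i \in codom t)%:R)).
      by apply: ler_sum => i _; have [] := tpow_flip_le s i t.
    apply: (@le_trans _ _ (\sum_i (i \in codom t)%:R)).
      rewrite [leRHS](bigID D) /= lerDl; exact: sumr_ge0.
    rewrite -natr_sum ler_nat -card_pred_sum -[leqRHS]card_ord.
    exact: leq_image_card.
  have h2 : `|flips_coef s D t| <= \sum_(i | D i) flip_term s i t.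
    apply: le_trans (ler_norm_sum _ _ _) _.
    by apply: ler_sum => i _; have [] := tpow_flip_le s i t.
  exact: ler_pM.
apply: (@le_trans _ _ (\sum_t r%:R * \sum_(i | D i) flip_term s i t)).
  exact: ler_sum.
rewrite -mulr_sumr expr2 -!mulrA ler_wpM2l// exchange_big /=.
apply: (@le_trans _ _ (\sum_(i | D i) r%:R * N%:R ^+ r.-1)); last first.
  by rewrite sumr_const -[leLHS]mulr_natr mulrAC mulrA.
apply: ler_sum => i _; rewrite exchange_big /=.
apply: (@le_trans _ _ (\sum_(j < r) N%:R ^+ r.-1)); last first.
  by rewrite sumr_const card_ord mulr_natl.
apply: ler_sum => j _.
rewrite (sum_tensor (fun l x => if l == j then (x == i)%:R else sup s i x)).
rewrite (bigD1 j)//= eqxx.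
have -> : \sum_x (x == i)%:R = 1 :> R.
  by rewrite (bigD1 i)//= eqxx big1 ?addr0// => x /negPf ->.
rewrite mul1r -[X in _ ^+ X.-1]card_ord.
have -> : #|'I_r|.-1 = #|predC1 j| by rewrite cardC1.
rewrite -prodr_const; apply: ler_prod => l /negPf lj; rewrite lj.
apply/andP; split; first by apply: sumr_ge0 => x _; rewrite ler0n.
rewrite /sup -natr_sum ler_nat; apply: leq_trans sN.
apply: (@leq_trans (\sum_x ((x == i) + s x))).
  by apply: leq_sum => x _; case: (x == i); case: (s x).
rewrite big_split /= -nnz_sum (bigD1 i)//= eqxx big1 ?addn0 ?add1n//.
by move=> x /negPf ->.
Qed.

Lemma inner_rvec s v : inner (rvec R s) (rvec R v) = (overlap v s)%:R.
Proof.
rewrite /inner overlap_sum natr_sum.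
by apply: eq_bigr => i _; rewrite /rvec -natrM mulnb.
Qed.

(** The half-integer power becomes an integer power of a square root, which makes the penalty
    estimates algebraic. *)
Lemma search_objectiveE k gamma lambda v W s :
  search_objective gamma (observation k lambda v W) s =
  lambda / k%:R `^ (r%:R / 2) * (overlap v s)%:R ^+ r + noise W s -
  gamma * Num.sqrt (nnz s)%:R ^+ r.+1.
Proof.
rewrite /search_objective /objective; congr (_ - gamma * _).
  rewrite /inner; under eq_bigr do rewrite mulrDr.
  rewrite big_split /=; congr (_ + _).
  under eq_bigr do rewrite mulrCA.
  rewrite -mulr_sumr; congr (_ * _); have := inner_tpow (rvec R s) (rvec R v).
  by rewrite {1}/inner => ->; rewrite inner_rvec.
by rewrite natr1 mulrC powRrM powR12_sqrt// powR_mulrn.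
Qed.
End Tensor.

(** * Increments and size of the penalty *)

Section Penalty.
Variable R : realType.

Lemma exprB_le (x y : R) N : 0 <= x -> x <= y ->
  y ^+ N.+1 - x ^+ N.+1 <= N.+1%:R * (y - x) * y ^+ N.
Proof.
move=> x0 xy; have y0 : 0 <= y by exact: le_trans xy.
elim: N => [|N IH]; first by rewrite !expr1 expr0 mulr1 mul1r.
rewrite exprS [x ^+ N.+2]exprS.
have h1 : y * (y ^+ N.+1 - x ^+ N.+1) <= y * (N.+1%:R * (y - x) * y ^+ N).
  by rewrite ler_wpM2l.
have h2 : (y - x) * x ^+ N.+1 <= (y - x) * y ^+ N.+1.
  by rewrite ler_wpM2l ?subr_ge0// lerXn2r ?nnegrE.
have e1 : y * (N.+1%:R * (y - x) * y ^+ N) = N.+1%:R * (y - x) * y ^+ N.+1.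
  by rewrite [y ^+ N.+1]exprS; ring.
rewrite -[N.+2%:R]natr1; lra.
Qed.

Variables (q k : nat).
Let T (s : nat) : R := Num.sqrt s%:R ^+ q.+2.
Let K : R := Num.sqrt k%:R.

Lemma sqrtn_le2k s : (s <= 2 * k)%N -> Num.sqrt s%:R <= 2 * K :> R.
Proof.
move=> sk; have K0 : 0 <= K by exact: sqrtr_ge0.
rewrite -(ler_sqr (x := Num.sqrt s%:R)) ?nnegrE ?sqrtr_ge0 ?mulr_ge0//.
rewrite exprMn !sqr_sqrtr//.
have : s%:R <= (2 * k)%:R :> R by rewrite ler_nat.
rewrite natrM; have : 0 <= k%:R :> R by []. lra.
Qed.

Lemma penalty_incr_le s : (s.+1 <= 2 * k)%N ->
  T s.+1 - T s <= q.+2%:R * 2 ^+ q * K ^+ q.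
Proof.
move=> sk; set x : R := Num.sqrt s%:R; set y : R := Num.sqrt s.+1%:R.
have x0 : 0 <= x by exact: sqrtr_ge0.
have y0 : 0 <= y by exact: sqrtr_ge0.
have xy : x <= y by rewrite ler_sqrt// ler_nat.
have y2 : y ^+ 2 = x ^+ 2 + 1 by rewrite !sqr_sqrtr// natr1.
apply: le_trans (exprB_le q.+1 x0 xy) _.
(* Consecutive square roots satisfy [(y - x) * (y + x) = 1]. *)
have h : (y - x) * y <= 1.
  have : (y - x) * y <= (y - x) * (y + x) by rewrite ler_wpM2l ?subr_ge0// lerDl.
  rewrite mulrC -subr_sqr; lra.
have -> : q.+2%:R * (y - x) * y ^+ q.+1 = q.+2%:R * (((y - x) * y) * y ^+ q).
  by rewrite exprS; ring.
rewrite -[leRHS]mulrA ler_wpM2l// -exprMn.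
apply: (@le_trans _ _ (1 * y ^+ q)); first by rewrite ler_wpM2r ?exprn_ge0.
by rewrite mul1r lerXn2r ?nnegrE ?sqrtn_le2k// mulr_ge0 ?sqrtr_ge0.
Qed.

Lemma penalty_incr_ge s : (k <= s)%N -> K ^+ q <= T s.+1 - T s.
Proof.
move=> ks; set x : R := Num.sqrt s%:R; set y : R := Num.sqrt s.+1%:R.
have x0 : 0 <= x by exact: sqrtr_ge0.
have y0 : 0 <= y by exact: sqrtr_ge0.
have xy : x <= y by rewrite ler_sqrt// ler_nat.
have y2 : y ^+ 2 = x ^+ 2 + 1 by rewrite !sqr_sqrtr// natr1.
apply: (@le_trans _ _ (x ^+ q)).
  by rewrite lerXn2r ?nnegrE ?sqrtr_ge0// ler_sqrt// ler_nat.
have : x ^+ q <= y ^+ q by rewrite lerXn2r ?nnegrE.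
(* As [y^2 = x^2 + 1], the increment equals [y^q + x^2 * (y^q - x^q)]. *)
rewrite /T -/x -/y !(exprD _ 2 q) y2.
have : 0 <= x ^+ 2 * (y ^+ q - x ^+ q).
  by rewrite mulr_ge0 ?sqr_ge0// subr_ge0 lerXn2r ?nnegrE.
lra.
Qed.

Lemma penalty_le s : (s <= 2 * k)%N -> T s <= 2 ^+ q.+2 * k%:R * K ^+ q.
Proof.
move=> sk; rewrite (_ : 2 ^+ q.+2 * k%:R * K ^+ q = (2 * K) ^+ q.+2).
  by rewrite lerXn2r ?nnegrE ?sqrtn_le2k ?sqrtr_ge0// mulr_ge0 ?sqrtr_ge0.
rewrite exprMn -mulrA; congr (_ * _).
by rewrite -[q.+2]add2n exprD sqr_sqrtr.
Qed.
End Penalty.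

(** * Explicit constants depending only on the tensor order *)

Section Constants.
Variables (R : realType) (q : nat).
(** The noise level, large enough for [event_exponent]. In [cst_g] the penalty then beats the noise
    of two wrong coordinates per flip; [cst_q1] and [cst_q2] bound the increments and the size of
    the penalty. *)
Definition cst_A : R := 12 * q.+1%:R ^+ 2 * 2 ^+ q.+1.
Definition cst_g : R := 2 * cst_A + 1.
Definition cst_q1 : R := cst_g * (q.+2%:R * 2 ^+ q).
Definition cst_q2 : R := cst_g * 2 ^+ q.+2.
(** This is [16^q * Q] for the [Q] of the landscape analysis; [16^q] converts [(k / 16)^q] into
    [k^q]. *)
Definition cst_C0 : R := 16 ^+ q * (16 * (1 + 2 * cst_A + cst_q1 + cst_q2)).

Lemma cst_A_ge1 : 1 <= cst_A.
Proof.
have h : 1 <= q.+1%:R ^+ 2 * 2 ^+ q.+1 :> R.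
  by rewrite -!natrX -natrM ler1n muln_gt0 !expn_gt0.
by rewrite /cst_A -mulrA; lra.
Qed.

Lemma cst_g_ge1 : 1 <= cst_g.
Proof. by rewrite /cst_g; have := cst_A_ge1; lra. Qed.

Lemma cst_q1_ge0 : 0 <= cst_q1.
Proof. by rewrite mulr_ge0 ?(le_trans _ cst_g_ge1)// mulr_ge0// exprn_ge0. Qed.

Lemma cst_q2_ge0 : 0 <= cst_q2.
Proof. by rewrite mulr_ge0 ?(le_trans _ cst_g_ge1)// exprn_ge0. Qed.

Lemma cst_C0_gt0 : 0 < cst_C0.
Proof.
rewrite mulr_gt0 ?exprn_gt0//.
by have := cst_A_ge1; have := cst_q1_ge0; have := cst_q2_ge0; lra.
Qed.
End Constants.

(** * The noise events and their weighted union bound *)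

Section Events.
Variables (R : realType) (n q k : nat) (v : cube n).
Hypotheses (n_ge7 : (7 <= n)%N) (k_ge2 : (2 <= k)%N) (v_k : nnz v = k).
Local Notation A := (cst_A R q).
Let L : R := ln n%:R.
Let K : R := Num.sqrt k%:R.
Let kappa : R := Num.sqrt L * K ^+ q.

(** Each state [s] carries [n + 3] events: the bad flips ([inl true]), the missing flips
    ([inl false]), the noise value at [s] ([inr None]) and the flip at [i] ([inr (Some i)]). *)
Definition event : finType := (cube n * (bool + option 'I_n))%type.
Implicit Type j : event.

Definition event_ok j : bool := (2 * nnz j.1 <= 3 * k)%N.
Definition event_dist j : nat := hamming j.1 v.
(* Outside the region where the events are needed the coefficients vanish, and
   the larger scale keeps the tail bound below [event_weight]. *)
Definition event_scale j : nat := if event_ok j then k else (k + event_dist j)%N.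

Definition event_coef j (t : midx q.+1 n) : R :=
  if event_ok j then
    match j.2 with
    | inl b => flips_coef R j.1 (if b then bad v j.1 else missing v j.1) t
    | inr None => tpow (rvec R j.1) t
    | inr (Some i) => flips_coef R j.1 (pred1 i) t
    end
  else 0.

(** The maximum with 1 matters only at [s = v], where it keeps the variance bound [event_var]
    positive. *)
Definition event_bound j : R :=
  match j.2 with
  | inl _ => A * (maxn (event_dist j) 1)%:R * kappa
  | inr None => A * (event_scale j)%:R * kappa
  | inr (Some _) => A * Num.sqrt (event_scale j)%:R * kappa
  end.

Definition event_var j : R :=
  match j.2 with
  | inl _ => q.+1%:R ^+ 2 * (maxn (event_dist j) 1)%:R * (2 * k)%:R ^+ q
  | inr None => (2 * k)%:R ^+ q.+1
  | inr (Some _) => q.+1%:R ^+ 2 * (2 * k)%:R ^+ q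
  end.

Definition event_weight j : R := (n%:R ^+ 4)^-1 * (n%:R ^+ 3)^-1 ^+ event_dist j.

Let A0 : 0 <= A := le_trans ler01 (cst_A_ge1 R q).
Let L0 : 0 < L.
Proof. by rewrite ln_gt0// ltr1n (leq_trans _ n_ge7). Qed.
Let kappa0 : 0 < kappa.
Proof.
by rewrite mulr_gt0 ?sqrtr_gt0// exprn_gt0// sqrtr_gt0 ltr0n (leq_trans _ k_ge2).
Qed.
Let kappa_sqr : kappa ^+ 2 = L * k%:R ^+ q.
Proof. by rewrite exprMn sqr_sqrtr ?(ltW L0)// -exprM mulnC exprM sqr_sqrtr. Qed.

Lemma event_bound_ge0 j : 0 <= event_bound j.
Proof.
by rewrite /event_bound; case: j.2 => [_|[_|]]; rewrite mulr_ge0 ?(ltW kappa0)// mulr_ge0// sqrtr_ge0.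
Qed.

Lemma event_var_gt0 j : 0 < event_var j.
Proof.
have k0 : 0 < (2 * k)%:R :> R by rewrite ltr0n muln_gt0 (leq_trans _ k_ge2).
rewrite /event_var; case: j.2 => [_|[_|]]; rewrite ?exprn_gt0//.
  by rewrite !mulr_gt0 ?exprn_gt0// ltr0n leq_max orbT.
by rewrite mulr_gt0 ?exprn_gt0.
Qed.

Lemma sum_event_coef_sqr j : \sum_t event_coef j t ^+ 2 <= event_var j.
Proof.
rewrite /event_coef /event_var; have [ok|_] := boolP (event_ok j); last first.
  rewrite big1; last by move=> t _; rewrite expr0n.
  exact/ltW/event_var_gt0.
have sk : (nnz j.1 < 2 * k)%N by move: ok k_ge2; rewrite /event_ok; clear; lia.
case: j.2 => [b|[i|]] /=.
- apply: le_trans (@sum_flips_coef_sqr R n q.+1 j.1 _ (2 * k) sk) _.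
  rewrite /= ler_wpM2r ?exprn_ge0// ler_wpM2l ?exprn_ge0// ler_nat leq_max.
  rewrite /event_dist hamming_bad_missing.
  by case: b; rewrite ?leq_addr ?leq_addl.
- apply: le_trans (@sum_flips_coef_sqr R n q.+1 j.1 _ (2 * k) sk) _.
  by rewrite /= card1 mulr1.
- by rewrite sum_tpow_sqr lerXn2r ?nnegrE// ler_nat ltnW.
Qed.

Let A_sqr : 12 * (q.+1%:R ^+ 2 * 2 ^+ q.+1) <= A ^+ 2.
Proof. by rewrite mulrA -/(cst_A R q) expr2 ler_peMl// cst_A_ge1. Qed.

Let A_sqr' : 12 * (2 * 2 ^+ q.+1) <= A ^+ 2.
Proof.
have e2 : 2 <= 2 ^+ q.+1 :> R by rewrite exprS ler_peMr// exprn_ege1// ler1n.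
have h : 2 ^+ q.+1 <= q.+1%:R ^+ 2 * 2 ^+ q.+1 :> R.
  by rewrite ler_peMl// ?exprn_ge0// exprn_ege1// ler1n.
have A12 : 12 * 2 ^+ q.+1 <= A by rewrite /cst_A -mulrA; lra.
rewrite mulrCA expr2; apply: ler_pM; lra.
Qed.

Let exponent_aux (x y Z B : R) : 0 <= x -> 0 <= y -> 0 <= Z -> 0 <= B ->
  x <= 12 * y -> 12 * B <= A ^+ 2 -> x * B * Z <= A ^+ 2 * y * Z.
Proof.
move=> x0 y0 Z0 B0 xy BA; rewrite ler_wpM2r//.
apply: (@le_trans _ _ (12 * y * B)); first by rewrite ler_wpM2r.
by rewrite mulrAC ler_wpM2r.
Qed.

(** When [event_ok] holds, the distance is at most [nnz s + k <= 5k/2]; otherwise the scale contains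
    the distance. *)
Lemma event_dist_scale j : (3 * event_dist j + 4 <= 12 * event_scale j)%N.
Proof.
rewrite /event_scale /event_ok; case: ifP => [ok|_]; last by move: k_ge2; clear; lia.
have := hamming_bad_missing v j.1; have := nnz_overlap v j.1; have := k_overlap v_k j.1.
by rewrite /event_dist; move: ok k_ge2; clear; lia.
Qed.

(** Since [kappa^2 = L * k^q], the powers of [k] cancel and the quotient is at least [12 * L] times
    the distance (or 1) or the scale, by the choice of [cst_A]. *)
Lemma event_exponent j :
  (3 * event_dist j + 4)%:R * L <= event_bound j ^+ 2 / (2 * event_var j).
Proof.
rewrite ler_pdivlMr ?mulr_gt0 ?event_var_gt0//.
have kq0 : 0 <= k%:R ^+ q :> R by rewrite exprn_ge0.
have LK0 : 0 <= L * k%:R ^+ q by rewrite mulr_ge0 ?(ltW L0).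
have B0 : 0 <= q.+1%:R ^+ 2 * 2 ^+ q.+1 :> R by rewrite mulr_ge0 ?exprn_ge0.
rewrite /event_bound /event_var; have := event_dist_scale j.
rewrite -(ler_nat R) natrM => ds.
case: j.2 => [_|[_|]].
- set m1 := maxn _ _; rewrite 2!exprMn kappa_sqr natrM exprMn.
  have d1 : (3 * event_dist j + 4)%:R <= 12 * m1%:R :> R.
    by rewrite -natrM ler_nat /m1; clear; lia.
  have Z0 : 0 <= m1%:R * (L * k%:R ^+ q) by rewrite mulr_ge0.
  have := exponent_aux (ler0n _ _) (ler0n _ _) Z0 B0 d1 A_sqr.
  rewrite [2 ^+ q.+1]exprS.
  by congr (_ <= _); ring.
- rewrite 2!exprMn kappa_sqr natrM exprMn sqr_sqrtr//.
  have := exponent_aux (ler0n _ _) (ler0n _ _) LK0 B0 ds A_sqr.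
  rewrite [2 ^+ q.+1]exprS.
  by congr (_ <= _); ring.
- rewrite 2!exprMn kappa_sqr natrM exprMn.
  have Z0 : 0 <= k%:R * (L * k%:R ^+ q) by rewrite mulr_ge0.
  have B0' : 0 <= 2 * 2 ^+ q.+1 :> R by rewrite mulr_ge0 ?exprn_ge0.
  have le1 := exponent_aux (ler0n _ _) (ler0n _ _) Z0 B0' ds A_sqr'.
  (* The variance of the noise value has one more factor [k], absorbed by one factor of the squared
     scale. *)
  have kk : k%:R <= (event_scale j)%:R :> R.
    by rewrite ler_nat /event_scale; case: ifP => // _; exact: leq_addr.
  apply: (@le_trans _ _ (A ^+ 2 * (event_scale j)%:R * (k%:R * (L * k%:R ^+ q)))).
    apply: le_trans le1; rewrite le_eqVlt; apply/orP; left; apply/eqP.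
    by rewrite [k%:R ^+ q.+1]exprS; ring.
  have kkZ : (event_scale j)%:R * (k%:R * (L * k%:R ^+ q)) <=
      (event_scale j)%:R ^+ 2 * (L * k%:R ^+ q).
    by rewrite expr2 -[leRHS]mulrA ler_wpM2l// ler_wpM2r.
  by rewrite -[leLHS]mulrA -[leRHS]mulrA; apply: ler_wpM2l; rewrite ?sqr_ge0.
Qed.

Lemma event_tail_le_weight j :
  expR (- (event_bound j ^+ 2 / (2 * event_var j))) <= event_weight j.
Proof.
have n0 : 0 < n%:R :> R by rewrite ltr0n (leq_trans _ n_ge7).
apply: (@le_trans _ _ (expR (- ((3 * event_dist j + 4)%:R * L)))).
  by rewrite ler_expR lerN2 event_exponent.
rewrite expRN expRM_natl lnK ?posrE// addnC exprD exprM invfM /event_weight.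
by rewrite exprVn.
Qed.

(** The sum factors over coordinates, each agreeing with [v] or contributing [x]. *)
Lemma sum_hamming_exp (x : R) :
  \sum_(s : cube n) x ^+ hamming s v = (1 + x) ^+ n.
Proof.
transitivity (\prod_(i < n) \sum_(b : bool) (if b != v i then x else 1)).
  rewrite bigA_distr_bigA; apply: eq_bigr => s _ /=.
  rewrite /hamming -prodr_const big_mkcond /=; apply: eq_bigr => i _.
  by rewrite inE.
rewrite -[n in RHS]card_ord -prodr_const; apply: eq_bigr => i _.
rewrite big_bool; case: (v i) => /=; first by rewrite addrC.
by rewrite addrC.
Qed.

Lemma sum_event_weight : \sum_j event_weight j <= 24^-1.
Proof.
have n7 : 7 <= n%:R :> R by rewrite (ler_nat R 7).
have n0 : 0 < n%:R :> R by lra.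
set x : R := (n%:R ^+ 3)^-1.
have x0 : 0 <= x by rewrite invr_ge0 exprn_ge0.
have nx : n%:R * x <= 2^-1.
  rewrite /x exprS invfM mulrA mulfV ?gt_eqF// mul1r lef_pV2 ?posrE ?exprn_gt0//.
  have : 7 * 7 <= n%:R * n%:R :> R by exact: ler_pM.
  rewrite expr2; lra.
(* Through [(1 + x)^n <= exp (n x) <= 1 / (1 - n x)] with [n x <= 1/2]. *)
have le2 : (1 + x) ^+ n <= 2.
  apply: (@le_trans _ _ (expR (n%:R * x))).
    rewrite expRM_natl lerXn2r ?nnegrE ?expR_ge0 ?expR_ge1Dx//; lra.
  rewrite -[leRHS]invrK -[expR _]invrK lef_pV2 ?posrE ?invr_gt0 ?expR_gt0//.
  rewrite -expRN; have := expR_ge1Dx (- (n%:R * x)); lra.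
have -> : \sum_j event_weight j = (n%:R + 3) * (n%:R ^+ 4)^-1 * (1 + x) ^+ n.
  rewrite -sum_hamming_exp mulr_sumr.
  rewrite -(pair_bigA _ (fun s _ => (n%:R ^+ 4)^-1 * x ^+ hamming s v)) /=.
  apply: eq_bigr => s _; rewrite sumr_const card_sum card_bool card_option card_ord.
  by rewrite -[LHS]mulr_natl mulrA -natrD; congr (_%:R * _ * _); clear; lia.
apply: (@le_trans _ _ ((n%:R + 3) * (n%:R ^+ 4)^-1 * 2)).
  by rewrite ler_wpM2l// mulr_ge0 ?invr_ge0 ?exprn_ge0//; lra.
rewrite mulrAC ler_pdivrMr ?exprn_gt0//.
have n2 : 7 * 7 <= n%:R * n%:R :> R by exact: ler_pM.
have : 49 * (7 * n%:R) <= n%:R ^+ 4 :> R.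
  have -> : n%:R ^+ 4 = (n%:R * n%:R) * (n%:R * n%:R) :> R by ring.
  by apply: ler_pM => //; [lra|rewrite ler_wpM2r//; lra].
lra.
Qed.
End Events.

(** * The success bound at fixed [n] *)

Section Finite.
Variables (R : realType) (n q k M : nat) (lambda : R).
Hypotheses (n_ge7 : (7 <= n)%N) (k_ge2 : (2 <= k)%N).
Local Notation A := (cst_A R q).
Local Notation C0 := (cst_C0 R q).
Let l : R := Num.sqrt (ln n%:R).
Let K : R := Num.sqrt k%:R.
Let kappa : R := l * K ^+ q.
Let rho : R := lambda / k%:R `^ (q.+1%:R / 2).
Hypothesis strong_signal : C0 * kappa <= rho * k%:R ^+ q.
Hypothesis many_steps :
  12 * (C0 + 2 * A + cst_q2 R q) * n%:R * k%:R * K <= M%:R.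

Lemma event_success (v s : cube n) (X : midx q.+1 n -> R) :
  nnz v = k -> (2 * nnz s <= 3 * k)%N -> (k <= 8 * overlap v s)%N ->
  (forall j : event n, `|\sum_t event_coef R k v j t * X t| <= event_bound R q k v j) ->
  11 / 12 <= local_search k
    (search_objective (cst_g R q * l) (observation k lambda v X)) M s v.
Proof.
move=> vk s3k ks good.
have k0 : 0 < k%:R :> R by rewrite ltr0n (ltn_trans _ k_ge2).
have l0 : 0 < l by rewrite sqrtr_gt0 ln_gt0// ltr1n (leq_trans _ n_ge7).
have K1 : 1 <= K by rewrite -(@sqrtr1 R) ler_sqrt// ler1n (ltn_trans _ k_ge2).
have K0 : 0 < K by lra.
have kappa0 : 0 < kappa by rewrite mulr_gt0// exprn_gt0.
have kq0 : 0 < k%:R ^+ q :> R by rewrite exprn_gt0.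
have A1 := cst_A_ge1 R q; have g1 := cst_g_ge1 R q.
have C00 := cst_C0_gt0 R q.
(* The cap bounds the energy range. When it is attained, [S * (k / 16)^q] equals [Q * K * kappa],
   the threshold required by [S_eq]. *)
pose S := Num.min rho (C0 * K * kappa / k%:R ^+ q).
have SkE : S * k%:R ^+ q = Num.min (rho * k%:R ^+ q) (C0 * K * kappa).
  by rewrite /S minr_pMl ?(ltW kq0)// divfK ?gt_eqF.
have x0E : (k%:R / 16) ^+ q = k%:R ^+ q / 16 ^+ q :> R by rewrite exprMn exprVn.
have S16 (x : R) : 16 ^+ q * x <= S * k%:R ^+ q -> x <= S * (k%:R / 16) ^+ q.
  by rewrite x0E mulrA ler_pdivlMr ?exprn_gt0// mulrC.
have CK : C0 * kappa <= C0 * K * kappa.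
  by rewrite ler_wpM2r ?(ltW kappa0)// ler_peMr// ltW.
pose T (s : nat) : R := cst_g R q * l * Num.sqrt s%:R ^+ q.+2.
have -> : search_objective (cst_g R q * l) (observation k lambda v X) =
    energy q v (noise X) T rho.
  by apply/funext => s'; rewrite search_objectiveE.
have gl0 : 0 <= cst_g R q * l by rewrite mulr_ge0 ?(ltW l0)//; lra.
have okP s' x : (2 * nnz s' <= 3 * k)%N -> event_ok k (s', x) by [].
apply: (@landscape_local_search R n q k v (noise X) T rho S K kappa A
  (cst_g R q) (cst_q1 R q) (cst_q2 R q) C0) => //.
- by lra.
- exact: cst_q1_ge0.
- exact: cst_q2_ge0.
- move=> s' D s'3k s'v Db; rewrite noise_flips.
  have m1 : maxn (hamming s' v) 1 = hamming s' v.
    apply/maxn_idPl; rewrite lt0n; apply: contraNneq s'v => /card0_eq h.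
    by apply/eqP/ffunP => i; have := h i; rewrite !inE => /negbFE/eqP.
  by case: Db => ->; [have := good (s', inl true)|have := good (s', inl false)];
    rewrite /event_bound /event_coef okP//= /event_dist m1.
- move=> s' s'3k; have := good (s', inr None).
  by rewrite /event_bound /event_coef /event_scale okP.
- move=> s' i s'3k; have := good (s', inr (Some i)).
  rewrite /event_bound /event_coef /event_scale okP//= -noise_flips.
  by rewrite big_pred1_eq.
- move=> m mk; rewrite /T -mulrBr.
  have := ler_wpM2l gl0 (penalty_incr_le R q mk); rewrite /kappa /cst_q1 /K.
  by congr (_ <= _); ring.
- move=> m mk; rewrite /T -mulrBr.
  have := ler_wpM2l gl0 (penalty_incr_ge R q mk); rewrite /kappa /K.
  by rewrite mulrA.
- by move=> m; rewrite mulr_ge0// exprn_ge0// sqrtr_ge0.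
- move=> m mk; have := ler_wpM2l gl0 (penalty_le R q mk); rewrite /kappa /cst_q2 /T /K.
  by congr (_ <= _); ring.
- have Ck0 : 0 <= C0 * kappa by exact/ltW/mulr_gt0.
  rewrite -(pmulr_lge0 _ kq0) SkE le_min (le_trans Ck0 strong_signal).
  exact: le_trans CK.
- by rewrite /S ge_min lexx.
- apply: S16; rewrite mulrA -/(cst_C0 R q) SkE le_min strong_signal.
  exact: CK.
- by rewrite SkE ge_min lexx orbT.
- have [Sr|Sr] := leP rho (C0 * K * kappa / k%:R ^+ q); first by left; apply/min_idPl.
  right; apply: S16; rewrite !mulrA -/(cst_C0 R q) /S (min_idPr (ltW Sr)) divfK ?gt_eqF//.
  by rewrite /cst_C0 !mulrA.
- by rewrite (leq_trans _ n_ge7).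
Qed.

Lemma finite_success d (Omega : measurableType d) (P : probability Omega R)
    (theta : Omega -> cube n) (W : midx q.+1 n -> {RV P >-> R})
    (sigma0 : Omega -> cube n) :
  planted_model k theta W ->
  {ae P, forall w,
     8^-1 * k%:R <= inner (rvec R (sigma0 w)) (rvec R (theta w)) /\
     (nnz (sigma0 w))%:R <= 3 / 2 * k%:R :> R} ->
  ((2 / 3)%:E <=
   success_probability k M (cst_g R q * l) lambda theta sigma0 W)%E.
Proof.
move=> model init.
have vk (v : cube n) : v \in sparse n k -> nnz v = k by rewrite inE => /eqP.
apply: (@success_probability_ge _ _ _ _ _ _ _ _ _ _ _ _ _ model
  (fun v s => (2 * nnz s <= 3 * k)%N /\ (k <= 8 * overlap v s)%N) _
  (event n) (fun v => event_coef R k v) (fun v => event_bound R q k v)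
  (fun v => event_var R q k v) (fun v => event_weight R v)).
- apply: filterS init => w [h1 h2]; rewrite inner_rvec in h1.
  by rewrite -!(ler_nat R) !natrM; split; lra.
- by move=> v j _; exact: event_bound_ge0.
- by move=> v j _; exact: event_var_gt0.
- by move=> v j _; exact: sum_event_coef_sqr.
- by move=> v j /vk vk'; apply: event_tail_le_weight.
- by move=> v _; exact: sum_event_weight.
- by move=> v s X /vk vk' [s3k ks]; exact: event_success.
Qed.
End Finite.

(** * Asymptotic form *)

Theorem theorem2p5 (R : realType) (r : nat) (k : nat -> nat) :
  (2 <= r)%N ->
  (forall n, (k n <= n)%N) ->
  isOmega (fun n => (k n)%:R : R) (fun n => Num.sqrt n%:R) ->
  exists gamma : nat -> R,
    isTheta gamma (fun n => Num.sqrt (ln n%:R)) /\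
  exists (a : nat) (c : R), 0 < c /\
  forall (C : R) (M : nat -> nat) (lambda : nat -> R),
    theta_with c C (fun n => (M n)%:R)
      (fun n => n%:R * (k n)%:R `^ ((r%:R + 1) / 2)) ->
    is_omega lambda
      (fun n => ln n%:R ^+ a *
                (n%:R `^ ((r%:R - 1) / 2) / (k n)%:R `^ (r%:R / 2 - 1))) ->
  \forall n \near \oo,
  forall (d : measure_display) (Omega : measurableType d)
    (P : probability Omega R)
    (theta : Omega -> cube n) (W : midx r n -> {RV P >-> R})
    (sigma0 : Omega -> cube n),
    planted_model (k n) theta W ->
    cube_measurable sigma0 ->
    {ae P, forall w,
       8^-1 * (k n)%:R <= inner (rvec R (sigma0 w)) (rvec R (theta w)) /\
       (nnz (sigma0 w))%:R <= 3 / 2 * (k n)%:R :> R} ->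
    ((2 / 3)%:E <=
     success_probability (k n) (M n) (gamma n) (lambda n) theta sigma0 W)%E.

Proof.
case: r => [//|q] q1 kn [c1 c10 k_sqrt].
exists (fun n => cst_g R q * Num.sqrt (ln n%:R)); split.
  have g0 : 0 < cst_g R q by have := cst_g_ge1 R q; lra.
  by exists (cst_g R q), (cst_g R q); split => //; apply: nearW => n; rewrite lexx.
pose c0 := 12 * (cst_C0 R q + 2 * cst_A R q + cst_q2 R q).
have C00 := cst_C0_gt0 R q.
have c0_gt0 : 0 < c0.
  by have := cst_A_ge1 R q; have := cst_q2_ge0 R q; rewrite /c0; lra.
(* One factor [ln n] suffices: it dominates the [sqrt (ln n)] in [kappa] once [ln n >= 1]. *)
exists 1%N, c0; split => //.
move=> C M lambda hM /(_ _ C00) hlambda.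
near=> n => d Omega P theta W sigma0 model _ init.
have n7 : (7 <= n)%N by near: n; exact: nbhs_infty_ge.
have n0 : 0 < n%:R :> R by rewrite ltr0n (leq_trans _ n7).
have L1 : 1 <= ln n%:R :> R.
  rewrite -[leLHS](expRK 1) ler_ln ?posrE ?expR_gt0//.
  by near: n; exact: nbhs_infty_ger.
have L0 : 0 < ln n%:R :> R by exact: lt_le_trans L1.
have k2 : (2 <= k n)%N.
  rewrite -(ler_nat R).
  have ks : c1 * Num.sqrt n%:R <= (k n)%:R by near: n.
  apply: le_trans ks; rewrite mulrC -ler_pdivrMr//.
  rewrite -[leLHS]ger0_norm ?divr_ge0 ?(ltW c10)// -sqrtr_sqr ler_sqrt//.
  by near: n; exact: nbhs_infty_ger.
have k0 : 0 < (k n)%:R :> R by rewrite ltr0n (ltn_trans _ k2).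
have K1 : 1 <= Num.sqrt (k n)%:R :> R.
  by rewrite -[leLHS](@sqrtr1 R) ler_sqrt// ler1n (ltn_trans _ k2).
have half_pow (x : R) m : 0 <= x -> x `^ (m%:R / 2) = Num.sqrt x ^+ m.
  by move=> x0; rewrite mulrC powRrM powR12_sqrt// powR_mulrn// sqrtr_ge0.
(* Once the powers of [k] are cleared, this reduces to [sqrt (ln n) * sqrt k ^ q <= ln n * sqrt n ^
   q], where [k <= n] enters. *)
have strong : cst_C0 R q * (Num.sqrt (ln n%:R) * Num.sqrt (k n)%:R ^+ q) <=
    lambda n / (k n)%:R `^ (q.+1%:R / 2) * (k n)%:R ^+ q.
  have : cst_C0 R q * (ln n%:R ^+ 1 *
      (n%:R `^ ((q.+1%:R - 1) / 2) / (k n)%:R `^ (q.+1%:R / 2 - 1))) <= lambda n.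
    by near: n.
  set p := (k n)%:R `^ (q.+1%:R / 2).
  have p0 : 0 < p by exact: powR_gt0.
  have -> : (k n)%:R `^ (q.+1%:R / 2 - 1) = (k n)%:R ^+ q / p.
    rewrite -powR_mulrn ?ler0n// -powRN -powRD; last by rewrite (gt_eqF k0) implybT.
    by congr (_ `^ _); rewrite -natr1; field.
  rewrite expr1 -natr1 addrK half_pow ?(ltW n0)// => le_lambda.
  have kq0 : 0 < (k n)%:R ^+ q :> R by exact: exprn_gt0.
  rewrite [leRHS]mulrAC ler_pdivlMr// -ler_pdivrMr//.
  apply: le_trans le_lambda.
  rewrite [leRHS](_ : _ = cst_C0 R q * (ln n%:R * Num.sqrt n%:R ^+ q) * p / (k n)%:R ^+ q);
    last by field; rewrite !gt_eqF.
  rewrite ler_pM2r ?invr_gt0// ler_pM2r// ler_pM2l//.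
  apply: ler_pM; [exact: sqrtr_ge0|exact/exprn_ge0/sqrtr_ge0| |].
    have l1 : 1 <= Num.sqrt (ln n%:R) :> R by rewrite -[leLHS](@sqrtr1 R) ler_sqrt ?(ltW L0).
    by rewrite -[leRHS](sqr_sqrtr (ltW L0)) expr2 ler_peMl ?sqrtr_ge0.
  by rewrite lerXn2r ?nnegrE ?sqrtr_ge0// ler_sqrt// ler_nat.
(* Order [n * k^(3/2)] steps are enough, and [3/2 <= (r + 1) / 2] because [r >= 2]. *)
have steps : c0 * n%:R * (k n)%:R * Num.sqrt (k n)%:R <= (M n)%:R.
  have /andP[le_M _] : c0 * (n%:R * (k n)%:R `^ ((q.+1%:R + 1) / 2)) <= (M n)%:R <=
      C * (n%:R * (k n)%:R `^ ((q.+1%:R + 1) / 2)) by near: n.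
  apply: le_trans le_M; rewrite natr1 half_pow// -[leLHS]mulrA -[leLHS]mulrA.
  rewrite ler_wpM2l ?(ltW c0_gt0)//
   ler_wpM2l//.
  rewrite (_ : _ * _ = Num.sqrt (k n)%:R ^+ 3); last by rewrite exprSr sqr_sqrtr.
  by rewrite ler_weXn2l.
exact: finite_success n7 k2 strong steps _ _ _ _ _ _ model init.
Unshelve. all: by end_near.
Qed.
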